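(* Let $\mathbb{K}$ be a field of characteristic zero, let $n\geq 3$ and let $\varphi\in\mathrm{GA}_n(\mathbb{K})$. Fix $1\leq r\leq n$, and for $c\in\mathbb{K}$ set $\theta_{r,c}=(x_1,\ldots,x_{r-1},x_r+c,x_{r+1},\ldots,x_n)$. If $\varphi^{-1}\theta_{r,c}\varphi$ is affine for each $c\in\mathbb{K}$, then $\varphi$ is either affine or co-tame.
   Context: $\mathrm{GA}_n(\mathbb{K})$ is the group of polynomial automorphisms of $\mathbb{A}^n_{\mathbb{K}}$. An element $\phi$ is written $\phi=(H_1,\ldots,H_n)$ with $H_i=(x_i)\phi\in\mathbb{K}[x_1,\ldots,x_n]$; for a polynomial $P$ one writes $(P)\phi=P(H_1,\ldots,H_n)$, and composition satisfies $(P)(\phi\psi)=((P)\phi)\psi$. $\mathrm{Aff}_n(\mathbb{K})$ is the affine subgroup (automorphisms all of whose components have degree one). $\mathrm{BA}_n(\mathbb{K})$ is the subgroup of triangular automorphisms $(u_1x_1+P_1,u_2x_2+P_2(x_1),\ldots,u_nx_n+P_n(x_1,\ldots,x_{n-1}))$ with $u_i\in\mathbb{K}^*$ and $P_i\in\mathbb{K}[x_1,\ldots,x_{i-1}]$. $\mathrm{TA}_n(\mathbb{K})=\langle \mathrm{Aff}_n(\mathbb{K}),\mathrm{BA}_n(\mathbb{K})\rangle$ is the tame subgroup. An automorphism $\phi\in\mathrm{GA}_n(\mathbb{K})$ is co-tame if $\mathrm{TA}_n(\mathbb{K})\subset\langle \phi,\mathrm{Aff}_n(\mathbb{K})\rangle$.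 *)

(* Defs.v *)
From HB Require Import structures.
From mathcomp Require Import all_boot all_order all_algebra.
From mathcomp.multinomials Require Import mpoly.

Set Implicit Arguments.
Unset Strict Implicit.
Unset Printing Implicit Defensive.

Import GRing.Theory.

Local Open Scope ring_scope.

Section PolynomialAutomorphisms.

Variables (K : fieldType) (n : nat).

Implicit Types (P : {mpoly K[n]}) (F G H : n.-tuple {mpoly K[n]}).

Definition endo_id : n.-tuple {mpoly K[n]} := [tuple 'X_i | i < n].

(* Substitution acts on the right: (P)(F G) = ((P)F)G, so the i-th coordinate *)
(* of the product F G is F_i(G_1, ..., G_n); see comp_mpoly_endo_mul.         *)
Definition endo_mul F G : n.-tuple {mpoly K[n]} :=
  [tuple tnth F i \mPo G | i < n].

Lemma comp_mpoly_endo_mul P F G : P \mPo endo_mul F G = (P \mPo F) \mPo G.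
Proof.
rewrite (comp_mpolyEX P (endo_mul F G)) (comp_mpolyEX P F) raddf_sum /=.
apply: eq_bigr => m _; rewrite comp_mpolyZ; congr (_ *: _).
rewrite !comp_mpolyX rmorph_prod /=; apply: eq_bigr => i _.
by rewrite tnth_mktuple rmorphXn.
Qed.

Lemma endo_mulA : associative endo_mul.
Proof.
move=> F G H; apply: eq_from_tnth => i.
by rewrite !tnth_mktuple comp_mpoly_endo_mul.
Qed.

Lemma endo_mul1 : right_id endo_id endo_mul.
Proof.
by move=> F; apply: eq_from_tnth => i; rewrite tnth_mktuple comp_mpoly_id.
Qed.

Lemma endo_1mul : left_id endo_id endo_mul.
Proof.
move=> F; apply: eq_from_tnth => i.
by rewrite !tnth_mktuple comp_mpolyXU -tnth_nth.
Qed.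

(* An automorphism is stored with its (unique) inverse, so that inversion is  *)
(* a total operation; equality only depends on the first component.           *)
Record GA : Type := MkGA {
  GA_pair : n.-tuple {mpoly K[n]} * n.-tuple {mpoly K[n]};
  _ : (endo_mul GA_pair.1 GA_pair.2 == endo_id) &&
      (endo_mul GA_pair.2 GA_pair.1 == endo_id)
}.

HB.instance Definition _ := [isSub for GA_pair].
HB.instance Definition _ := [Choice of GA by <:].

Implicit Types phi psi : GA.

Definition GA_endo phi : n.-tuple {mpoly K[n]} := (GA_pair phi).1.

Definition GA_coord phi (i : 'I_n) : {mpoly K[n]} := tnth (GA_endo phi) i.

Lemma GA_endoK phi :
  (endo_mul (GA_pair phi).1 (GA_pair phi).2 = endo_id) *
  (endo_mul (GA_pair phi).2 (GA_pair phi).1 = endo_id).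
Proof. by case: phi => p /= /andP[/eqP e1 /eqP e2]; split. Qed.

Lemma GA_endo_inj : injective GA_endo.
Proof.
move=> phi psi e; apply: val_inj; rewrite /GA_endo /= in e *.
have [e1 e2] := (GA_endoK phi, GA_endoK psi).
case: (GA_pair phi) (GA_pair psi) e e1 e2 => [f f'] [g g'] /= <- [e1 e1'] [e2 _].
by congr (_, _); rewrite -(endo_1mul g') -e1' -endo_mulA e2 endo_mul1.
Qed.

Fact GA_one_subproof :
  (endo_mul endo_id endo_id == endo_id) && (endo_mul endo_id endo_id == endo_id).
Proof. by rewrite endo_mul1 eqxx. Qed.

Definition GA_one : GA := @MkGA (endo_id, endo_id) GA_one_subproof.

Fact GA_mul_subproof phi psi :
  (endo_mul (endo_mul (GA_pair phi).1 (GA_pair psi).1)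
            (endo_mul (GA_pair psi).2 (GA_pair phi).2) == endo_id) &&
  (endo_mul (endo_mul (GA_pair psi).2 (GA_pair phi).2)
            (endo_mul (GA_pair phi).1 (GA_pair psi).1) == endo_id).
Proof.
rewrite -!endo_mulA; apply/andP; split; apply/eqP.
  by rewrite (endo_mulA _ (GA_pair psi).2) GA_endoK endo_1mul GA_endoK.
by rewrite (endo_mulA _ (GA_pair phi).1) GA_endoK endo_1mul GA_endoK.
Qed.

Definition GA_mul phi psi : GA :=
  @MkGA (endo_mul (GA_pair phi).1 (GA_pair psi).1,
         endo_mul (GA_pair psi).2 (GA_pair phi).2) (GA_mul_subproof phi psi).

Fact GA_inv_subproof phi :
  (endo_mul (GA_pair phi).2 (GA_pair phi).1 == endo_id) &&
  (endo_mul (GA_pair phi).1 (GA_pair phi).2 == endo_id).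
Proof. by rewrite !GA_endoK eqxx. Qed.

Definition GA_inv phi : GA :=
  @MkGA ((GA_pair phi).2, (GA_pair phi).1) (GA_inv_subproof phi).

Fact GA_mulA : associative GA_mul.
Proof. by move=> f g h; apply: GA_endo_inj; apply: endo_mulA. Qed.

Fact GA_mul1g : left_id GA_one GA_mul.
Proof. by move=> f; apply: GA_endo_inj; apply: endo_1mul. Qed.

Fact GA_mulg1 : right_id GA_one GA_mul.
Proof. by move=> f; apply: GA_endo_inj; apply: endo_mul1. Qed.

Fact GA_mulVg : left_inverse GA_one GA_inv GA_mul.
Proof. by move=> f; apply: GA_endo_inj; apply: (GA_endoK f).2. Qed.

Fact GA_mulgV : right_inverse GA_one GA_inv GA_mul.
Proof. by move=> f; apply: GA_endo_inj; apply: (GA_endoK f).1. Qed.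

HB.instance Definition _ :=
  isGroup.Build GA GA_mulA GA_mul1g GA_mulg1 GA_mulVg GA_mulgV.

Definition theta_endo (r : 'I_n) (c : K) : n.-tuple {mpoly K[n]} :=
  [tuple if i == r then 'X_i + c%:MP else 'X_i | i < n].

Lemma theta_endoK r c :
  endo_mul (theta_endo r c) (theta_endo r (- c)) = endo_id.
Proof.
apply: eq_from_tnth => i; rewrite !tnth_mktuple.
case: ifP => ir; rewrite ?comp_mpolyD ?comp_mpolyC comp_mpolyXU -tnth_nth;
  by rewrite tnth_mktuple ir // mpolyCN addrNK.
Qed.

Fact theta_subproof r c :
  (endo_mul (theta_endo r c) (theta_endo r (- c)) == endo_id) &&
  (endo_mul (theta_endo r (- c)) (theta_endo r c) == endo_id).
Proof. by rewrite theta_endoK -{2}(opprK c) theta_endoK eqxx. Qed.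

Definition theta (r : 'I_n) (c : K) : GA :=
  @MkGA (theta_endo r c, theta_endo r (- c)) (theta_subproof r c).

End PolynomialAutomorphisms.

Inductive generated_by (G : groupType) (S : G -> Prop) : G -> Prop :=
| generated_by_in x of S x : generated_by S x
| generated_by_1 : generated_by S 1%g
| generated_by_M x y of generated_by S x & generated_by S y :
    generated_by S (x * y)%g
| generated_by_V x of generated_by S x : generated_by S (x^-1)%g.

Section TameAutomorphisms.

Variables (K : fieldType) (n : nat).

Implicit Types phi psi : GA K n.

(* msize is one more than the total degree. *)
Definition affine phi : Prop := forall i, msize (GA_coord phi i) = 2%N.

Definition in_vars_below (i : 'I_n) (P : {mpoly K[n]}) : Prop :=
  forall m, m \in msupp P -> forall j : 'I_n, (i <= j)%N -> m j = 0%N.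

Definition triangular phi : Prop :=
  exists (u : 'I_n -> K) (P : 'I_n -> {mpoly K[n]}),
    forall i, [/\ u i != 0, in_vars_below i (P i)
                & GA_coord phi i = u i *: 'X_i + P i].

Definition tame : GA K n -> Prop :=
  generated_by (fun psi => affine psi \/ triangular psi).

Definition cotame phi : Prop :=
  forall psi, tame psi -> generated_by (fun rho => rho = phi \/ affine rho) psi.

End TameAutomorphisms.

(* Main.v *)
(* Let H_i be the coordinates of phi and let D = phi^-1 d_r phi, a locally nilpotent
   derivation with D H_i = delta_ir. The hypothesis says that D maps the coordinates
   to polynomials of degree at most one. Let G be generated by phi and the affine
   automorphisms. If G contains one nonaffine x_k -> x_k + f then it contains all tame ones:
   conjugating by affine automorphisms and differentiating, one obtains all quadratic
   f, then all f by conjugating x_l x_i with x_l -> x_l + x_i^d. Such an f is found from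
   any nonaffine chi in G with d_k chi_i = delta_ij, because such a chi conjugates
   x_j -> x_j + g into x_k -> x_k + g o chi.

   The set W of all g with D g = 0 whose flow exp(g D) lies in G is a vector space, it
   contains H_i for i <> r, and it is stable under the affine automorphisms that
   normalise D. If D x is constant then phi, composed with a linear map, is a chi as
   above. Otherwise it suffices to find a direction u that commutes with D and a
   nonconstant g in W with d_u g = 0: some exp(c g D) is then not affine, and it
   commutes with the translations along u. Let N be the linear part of D. If
   rank N <= n - 2, a nonconstant g of minimal degree in W has constant derivatives
   along ker N, one of which vanishes. If rank N >= n - 1, affine coordinates give
   D x_0 = a <> 0 and D x_i = x_(i-1); then u is the last coordinate direction and
   g is obtained by descent on the degree in the last coordinate, using two further
   affine fields that normalise D. *)
Require Import Defs.
From mathcomp Require Import all_boot all_order all_algebra.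
From mathcomp.multinomials Require Import mpoly.
From mathcomp Require Import perm ring.
From Stdlib Require Import Classical_Prop.

Set Implicit Arguments.
Unset Strict Implicit.
Unset Printing Implicit Defensive.

Import GRing.Theory.

Local Open Scope ring_scope.

(** * Derivations, first-order expansions and degrees of polynomials *)

Section MPolyFacts.

Variables (K : fieldType) (n : nat).

Implicit Types (p q P : {mpoly K[n]}) (i j k r : 'I_n).

Lemma mpoly_ring_ind (T : {mpoly K[n]} -> Prop) :
  (forall c, T c%:MP) -> (forall i, T 'X_i) ->
  (forall p q, T p -> T q -> T (p + q)) ->
  (forall p q, T p -> T q -> T (p * q)) -> forall p, T p.
Proof.
move=> TC TX TD TM; have TXm m : T 'X_[m].
  rewrite mpolyXE_id; elim/big_ind: _ => //; first by rewrite -mpolyC1; apply: TC.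
  move=> i _; elim: (m i) => [|d IHd]; first by rewrite expr0 -mpolyC1; apply: TC.
  by rewrite exprS; apply: TM.
elim/mpolyind => [|c m p _ _ Tp]; first by rewrite -mpolyC0; apply: TC.
by apply: TD => //; rewrite -mul_mpolyC; apply: TM.
Qed.

Definition derivation (d : {mpoly K[n]} -> {mpoly K[n]}) :=
  [/\ forall c, d c%:MP = 0, forall p q, d (p + q) = d p + d q
    & forall p q, d (p * q) = d p * q + p * d q].

Definition nth_fun (F : 'I_n -> {mpoly K[n]}) : n.-tuple {mpoly K[n]} :=
  [tuple F i | i < n].

Lemma comp_mpoly_tnth i (F : n.-tuple {mpoly K[n]}) : 'X_i \mPo F = tnth F i.
Proof. by rewrite comp_mpolyXU -tnth_nth. Qed.

Lemma comp_mpoly_fun i (F : 'I_n -> {mpoly K[n]}) : 'X_i \mPo nth_fun F = F i.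
Proof. by rewrite comp_mpoly_tnth tnth_mktuple. Qed.

Lemma comp_mpolyM p q (F : n.-tuple {mpoly K[n]}) :
  (p * q) \mPo F = (p \mPo F) * (q \mPo F).
Proof. exact: rmorphM. Qed.

Lemma comp_mpoly_sum (I : Type) (s : seq I) (Q : pred I) (E : I -> {mpoly K[n]})
    (F : n.-tuple {mpoly K[n]}) :
  (\sum_(i <- s | Q i) E i) \mPo F = \sum_(i <- s | Q i) (E i \mPo F).
Proof. exact: raddf_sum. Qed.

Lemma mderivXU i j : ('X_i : {mpoly K[n]})^`M(j) = (i == j)%:R.
Proof.
rewrite mderivX mnm1E; case: eqP => [->|_]; last by rewrite scale0r.
by rewrite scale1r -mpolyX0; congr 'X_[_]; apply/mnmP => k; rewrite mnmBE subnn mnm0E.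
Qed.

Lemma derivation_mderiv k : derivation (mderiv k).
Proof. by split=> [c|p q|p q]; rewrite (mderivC, mderivD, mderivM). Qed.

(** Chain rule. The polynomials [P] that satisfy it include the constants and the variables and are
    closed under sums and, by the Leibniz rule, under products. *)
Lemma derivation_comp (d : {mpoly K[n]} -> {mpoly K[n]}) P
    (F : n.-tuple {mpoly K[n]}) :
  derivation d ->
  d (P \mPo F) = \sum_i (P^`M(i) \mPo F) * d (tnth F i).
Proof.
case=> dC dD dM; elim/mpoly_ring_ind: P => [c|j|p q Hp Hq|p q Hp Hq].
- by rewrite comp_mpolyC dC big1 // => i _; rewrite mderivC comp_mpoly0 mul0r.
- rewrite comp_mpoly_tnth (bigD1 j) //= mderivXU eqxx comp_mpoly1 mul1r big1 ?addr0 //.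
  by move=> i ij; rewrite mderivXU eq_sym (negPf ij) comp_mpoly0 mul0r.
- rewrite comp_mpolyD dD Hp Hq -big_split; apply: eq_bigr => i _ /=.
  by rewrite mderivD comp_mpolyD mulrDl.
- rewrite comp_mpolyM dM Hp Hq mulr_suml mulr_sumr -big_split.
  by apply: eq_bigr => i _ /=; rewrite mderivM comp_mpolyD !comp_mpolyM; ring.
Qed.

Lemma derivationE (d : {mpoly K[n]} -> {mpoly K[n]}) P :
  derivation d -> d P = \sum_i P^`M(i) * d 'X_i.
Proof.
move=> dd; rewrite -{1}(comp_mpoly_id P) (derivation_comp _ _ dd).
by apply: eq_bigr => i _; rewrite comp_mpoly_id tnth_mktuple.
Qed.

Lemma derivationZ (d : {mpoly K[n]} -> {mpoly K[n]}) c p :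
  derivation d -> d (c *: p) = c *: d p.
Proof.
by case=> dC _ dM; rewrite -!mul_mpolyC dM dC mul0r add0r.
Qed.

Lemma derivation0 (d : {mpoly K[n]} -> {mpoly K[n]}) : derivation d -> d 0 = 0.
Proof. by case=> dC _ _; rewrite -mpolyC0 dC. Qed.

Lemma derivation_nat (d : {mpoly K[n]} -> {mpoly K[n]}) a :
  derivation d -> d a%:R = 0.
Proof. by case=> dC _ _; rewrite -mpolyC_nat dC. Qed.

Lemma derivationN (d : {mpoly K[n]} -> {mpoly K[n]}) p :
  derivation d -> d (- p) = - d p.
Proof. by move=> dd; rewrite -scaleN1r (derivationZ _ _ dd) scaleN1r. Qed.

Lemma derivation_sum (d : {mpoly K[n]} -> {mpoly K[n]}) (I : Type) (s : seq I)
    (Q : pred I) (F : I -> {mpoly K[n]}) :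
  derivation d -> d (\sum_(i <- s | Q i) F i) = \sum_(i <- s | Q i) d (F i).
Proof.
move=> dd; case: (dd) => _ dD _; elim/big_rec2: _ => [|i p q _ <-] //.
exact: derivation0.
Qed.

(** A commutator of derivations is a derivation, hence determined by its values on the variables. *)
Lemma derivation_bracket (d e f : {mpoly K[n]} -> {mpoly K[n]}) :
  derivation d -> derivation e -> derivation f ->
  (forall i, d (e 'X_i) - e (d 'X_i) = f 'X_i) ->
  forall p, d (e p) - e (d p) = f p.
Proof.
move=> [dC dD dM] [eC eD eM] [fC fD fM] H; elim/mpoly_ring_ind => [c|j|p q Hp Hq|p q Hp Hq].
- by rewrite eC dC fC -mpolyC0 dC eC subrr.
- exact: H.
- by rewrite eD !dD eD fD -Hp -Hq; ring.
- by rewrite fM -Hp -Hq eM dM !dD !eD !dM !eM; ring.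
Qed.

Definition vfield (a : 'I_n -> {mpoly K[n]}) P := \sum_i P^`M(i) * a i.

Lemma vfieldX a i : vfield a 'X_i = a i.
Proof.
rewrite /vfield (bigD1 i) //= mderivXU eqxx mul1r big1 ?addr0 // => j ij.
by rewrite mderivXU eq_sym (negPf ij) mul0r.
Qed.

Lemma derivation_vfield a : derivation (vfield a).
Proof.
split=> [c|p q|p q].
- by apply: big1 => i _; rewrite mderivC mul0r.
- by rewrite -big_split; apply: eq_bigr => i _; rewrite mderivD mulrDl.
- rewrite mulr_suml mulr_sumr -big_split; apply: eq_bigr => i _ /=.
  by rewrite mderivM; ring.
Qed.

Lemma derivation_zero : derivation (fun=> 0).
Proof. by split=> [c|p q|p q]; rewrite ?addr0 // mul0r mulr0 addr0. Qed.

Lemma derivation_scale a (d : {mpoly K[n]} -> {mpoly K[n]}) :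
  derivation d -> derivation (fun p => a *: d p).
Proof.
case=> dC dD dM; split=> [c|p q|p q]; first by rewrite dC scaler0.
  by rewrite dD scalerDr.
by rewrite dM scalerDr -scalerAl -scalerAr.
Qed.

Definition subspace (S : {mpoly K[n]} -> Prop) :=
  S 0 /\ forall c p q, S p -> S q -> S (c *: p + q).

Lemma subspaceZ S c p : subspace S -> S p -> S (c *: p).
Proof. by move=> [S0 SD] Sp; rewrite -[c *: p]addr0; apply: SD. Qed.

Lemma subspaceD S p q : subspace S -> S p -> S q -> S (p + q).
Proof. by move=> [S0 SD] Sp Sq; rewrite -[p]scale1r; apply: SD. Qed.

Lemma subspaceB S p q : subspace S -> S p -> S q -> S (p - q).
Proof. by move=> [S0 SD] Sp Sq; rewrite addrC -scaleN1r; apply: SD. Qed.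

Lemma subspace_sum S (I : Type) (s : seq I) (Q : pred I) (F : I -> {mpoly K[n]}) :
  subspace S -> (forall a, Q a -> S (F a)) -> S (\sum_(i <- s | Q i) F i).
Proof.
move=> sS SF; elim/big_ind: _ => //; first by case: sS.
by move=> p q; apply: subspaceD.
Qed.

Hypothesis K_char0 : [pchar K]%R =i pred0.

Lemma natf_eq0 (a : nat) : (a%:R == 0 :> K) = (a == 0%N).
Proof. by move/pcharf0P: K_char0 => ->. Qed.

(** Newton interpolation: dividing by ['X - m] leaves a quotient whose values at larger integers [a]
    are divided differences of [Q], and [a - m] is invertible in characteristic zero. *)
Lemma poly_interpolation S (Q : {poly {mpoly K[n]}}) :
  subspace S -> (forall a : nat, S Q.[a%:R]) -> forall e : nat, S Q`_e.
Proof.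
(* The quotient is controlled only beyond [m], so the starting integer has to vary in the
   induction. *)
move=> sS SQ; have {SQ}: forall a : nat, (0 <= a)%N -> S Q.[a%:R] by [].
move: {2}(size Q) (leqnn (size Q)) 0%N => d.
elim: d Q => [|d IHd] Q szQ m SQ e.
  by rewrite nth_default ?(leq_trans szQ) //; case: sS.
have /factor_theorem[R QR] : root (Q - Q.[m%:R]%:P) m%:R.
  by rewrite /root hornerD hornerN hornerC subrr.
have QE : Q = R * ('X - m%:R%:P) + Q.[m%:R]%:P by rewrite -QR subrK.
have SR : forall b : nat, S R`_b.
  apply: (IHd R _ m.+1) => [|a lt_ma].
    case: (eqVneq R 0) => [->|R0]; first by rewrite size_poly0.
    have := size_Mmonic R0 (monicXsubC (m%:R : {mpoly K[n]})).
    rewrite size_XsubC addn2 -QR /= => szR; rewrite -ltnS -szR (leq_trans _ szQ) // {szR}.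
    have [/size1_polyC E|gtQ] := leqP (size Q) 1.
      case/negP: (mulf_neq0 R0 (negbT (polyXsubC_eq0 (m%:R : {mpoly K[n]})))).
      by rewrite -QR E hornerC subrr.
    rewrite (leq_trans (size_polyD _ _)) // size_polyN size_polyC geq_max leqnn.
    by rewrite (leq_trans (leq_b1 _)) // ltnW.
  have: S (Q.[a%:R] - Q.[m%:R]) by apply: subspaceB => //; apply: SQ => //; apply: ltnW.
  rewrite {1}QE hornerD hornerM hornerXsubC hornerC addrK -natrB 1?ltnW //.
  move/(subspaceZ (a - m)%:R^-1 sS); rewrite mulr_natr -scaler_nat scalerA mulVf ?scale1r //.
  by rewrite natf_eq0 subn_eq0 -ltnNge.
rewrite QE coefD coefC mulrBr coefB coefMX coefMC.
have S0 : S 0 by exact: sS.1.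
apply: (subspaceD sS); last by case: ifP => _; [exact: SQ|exact: S0].
apply: (subspaceB sS); first by case: ifP => _; [exact: S0|exact: SR].
by rewrite mulr_natr -scaler_nat; apply: subspaceZ.
Qed.

(* The sum is the derivative of P o F(t) at t = 0. *)
Lemma subspace_first_order S P (F : 'I_n -> {poly {mpoly K[n]}}) :
  subspace S ->
  (forall a : nat, S (P \mPo nth_fun (fun i => (F i).[a%:R]))) ->
  S (\sum_i (P^`M(i) \mPo nth_fun (fun i => (F i)`_0)) * (F i)`_1).
Proof.
move=> sS SP; pose F0 := nth_fun (fun i => (F i)`_0).
(* [Q] is [P] o [F(t)] as a polynomial in [t], built along the ring structure of [P]; interpolation
   at the integers then puts its coefficients in [S]. *)
have [Q QE <-] : exists2 Q : {poly {mpoly K[n]}},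
    forall a, Q.[a] = P \mPo nth_fun (fun i => (F i).[a])
    & Q`_1 = \sum_i (P^`M(i) \mPo F0) * (F i)`_1.
  elim/mpoly_ring_ind: {SP}P => [c|j|p q [Q1 E1 D1] [Q2 E2 D2]|p q [Q1 E1 D1] [Q2 E2 D2]].
  - exists c%:MP%:P => [a|]; first by rewrite hornerC comp_mpolyC.
    by rewrite coefC big1 // => i _; rewrite mderivC comp_mpoly0 mul0r.
  - exists (F j) => [a|]; first by rewrite comp_mpoly_fun.
    rewrite (bigD1 j) //= mderivXU eqxx comp_mpoly1 mul1r big1 ?addr0 // => i ij.
    by rewrite mderivXU eq_sym (negPf ij) comp_mpoly0 mul0r.
  - exists (Q1 + Q2) => [a|]; first by rewrite hornerD E1 E2 comp_mpolyD.
    rewrite coefD D1 D2 -big_split; apply: eq_bigr => i _ /=.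
    by rewrite mderivD comp_mpolyD mulrDl.
  - exists (Q1 * Q2) => [a|]; first by rewrite hornerM E1 E2 comp_mpolyM.
    have H0 (Q : {poly {mpoly K[n]}}) f :
        (forall a, Q.[a] = f \mPo nth_fun (fun i => (F i).[a])) -> Q`_0 = f \mPo F0.
      move=> E; rewrite -horner_coef0 E /F0; congr (_ \mPo _).
      by apply: eq_from_tnth => i; rewrite !tnth_mktuple horner_coef0.
    rewrite coefM !big_ord_recl big_ord0 addr0 /= D1 D2 (H0 _ _ E1) (H0 _ _ E2).
    rewrite [X in X + _]mulr_sumr [X in _ + X]mulr_suml -big_split; apply: eq_bigr => i _ /=.
    by rewrite mderivM comp_mpolyD !comp_mpolyM; ring.
by apply: poly_interpolation => // a; rewrite QE.
Qed.

Lemma msize_le_coef p d :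
  (forall m, (d <= mdeg m)%N -> p@_m = 0) -> (msize p <= d)%N.
Proof.
move=> H; rewrite msizeE; apply/bigmax_leqP_seq => m mp _.
rewrite ltnNge; apply/negP => /H/eqP.
by rewrite mcoeff_eq0 mp.
Qed.

Lemma msize_mderiv p i : (msize p^`M(i) <= (msize p).-1)%N.
Proof.
apply: msize_le_coef => m dm; rewrite mcoeff_deriv.
rewrite (_ : p@_ _ = 0) ?mul0rn //; apply/eqP; rewrite mcoeff_eq0.
by apply: msize_mdeg_ge; rewrite mdegD mdeg1 addn1; case: (msize p) dm.
Qed.

Lemma iter_mderiv_eq0 p i d : (msize p <= d)%N -> iter d (mderiv i) p = 0.
Proof.
elim: d p => [|d IHd] p szp; first by apply/eqP; rewrite -msize_poly_eq0 -leqn0.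
rewrite iterSr; apply: IHd; apply: (leq_trans (msize_mderiv _ _)).
by case: (msize p) szp.
Qed.

Lemma affine_mpolyE p :
  (msize p <= 2)%N -> p = (p@_0%MM)%:MP + \sum_i p@_U_(i) *: 'X_i.
Proof.
move=> szp; apply/mpolyP => m; rewrite mcoeffD mcoeffC raddf_sum /=.
under eq_bigr do rewrite mcoeffZ mcoeffX.
have [->|m0] := eqVneq m 0%MM.
  rewrite mulr1 big1 ?addr0 // => i _.
  by rewrite (_ : (U_(i)%MM == 0%MM) = false) ?mulr0 // -mdeg_eq0 mdeg1.
rewrite mulr0 add0r; have [/mdeg1P[i /eqP->]|m1] := boolP (mdeg m == 1%N).
  rewrite (bigD1 i) //= eqxx mulr1 big1 ?addr0 // => j ij.
  rewrite (_ : (U_(j)%MM == U_(i)%MM) = false) ?mulr0 //.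
  apply/negP => /eqP/mnmP/(_ j); rewrite !mnm1E eqxx eq_sym (negPf ij) //.
rewrite big1 => [|i _].
  apply/eqP; rewrite mcoeff_eq0; apply: msize_mdeg_ge; apply: (leq_trans szp).
  by move: m0 m1; rewrite -mdeg_eq0; case: (mdeg m) => [|[|]].
rewrite (_ : (U_(i)%MM == m) = false) ?mulr0 //.
by apply: contraNF m1 => /eqP<-; rewrite mdeg1.
Qed.

Lemma msize_subspace d : subspace (fun p => (msize p <= d)%N).
Proof.
split=> [|c p q szp szq]; first by rewrite msize0.
rewrite (leq_trans (msizeD_le _ _)) // geq_max szq andbT.
exact: leq_trans (msizeZ_le _ _) szp.
Qed.

Lemma msizeX1 i : msize ('X_i : {mpoly K[n]}) = 2%N.
Proof. by rewrite msizeX mdeg1. Qed.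

Lemma msizeCle (c : K) d : (0 < d)%N -> (msize (c%:MP : {mpoly K[n]}) <= d)%N.
Proof. by move=> d0; rewrite msizeC (leq_trans (leq_b1 _)). Qed.

Lemma msize_comp_affine p (F : n.-tuple {mpoly K[n]}) :
  (msize p <= 2)%N -> (forall i, (msize (tnth F i) <= 2)%N) ->
  (msize (p \mPo F) <= 2)%N.
Proof.
move=> szp szF; rewrite (affine_mpolyE szp) comp_mpolyD comp_mpolyC raddf_sum /=.
have sS := msize_subspace 2.
apply: (subspaceD sS); first exact: msizeCle.
apply: (subspace_sum _ sS) => i _; rewrite comp_mpolyZ comp_mpoly_tnth.
by apply: (subspaceZ _ sS).
Qed.

End MPolyFacts.

Local Notation "P \oo phi" := (P \mPo GA_endo phi)
  (at level 50, left associativity, format "P  \oo  phi").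

(** * Elementary and affine automorphisms *)

Section Automorphisms.

Variables (K : fieldType) (n : nat).

Implicit Types (p q P f g : {mpoly K[n]}) (i j k r : 'I_n).
Implicit Types (phi psi chi : GA K n).

Lemma actM P phi psi : P \oo (phi * psi)%g = (P \oo phi) \oo psi.
Proof. exact: comp_mpoly_endo_mul. Qed.

Lemma act1 P : P \oo (1%g : GA K n) = P.
Proof. exact: comp_mpoly_id. Qed.

Lemma actK phi P : (P \oo phi) \oo phi^-1%g = P.
Proof. by rewrite -actM mulgV act1. Qed.

Lemma actVK phi P : (P \oo phi^-1%g) \oo phi = P.
Proof. by rewrite -actM mulVg act1. Qed.

Lemma actX i phi : 'X_i \oo phi = GA_coord phi i.
Proof. exact: comp_mpoly_tnth. Qed.

Lemma GA_coordM phi psi i : GA_coord (phi * psi)%g i = GA_coord phi i \oo psi.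
Proof. by rewrite -actX actM actX. Qed.

Lemma GA_coord1 i : GA_coord (1%g : GA K n) i = 'X_i.
Proof. by rewrite -actX act1. Qed.

Lemma GA_coord_inj phi psi : GA_coord phi =1 GA_coord psi -> phi = psi.
Proof. by move=> E; apply: GA_endo_inj; apply: eq_from_tnth. Qed.

Lemma GA_exists (F F' : 'I_n -> {mpoly K[n]}) :
  (forall i, F i \mPo nth_fun F' = 'X_i) ->
  (forall i, F' i \mPo nth_fun F = 'X_i) ->
  exists phi, (forall i, GA_coord phi i = F i) /\
              (forall i, GA_coord phi^-1%g i = F' i).
Proof.
move=> FF' F'F.
have P : (endo_mul (nth_fun F) (nth_fun F') == endo_id K n) &&
         (endo_mul (nth_fun F') (nth_fun F) == endo_id K n).
  by apply/andP; split; apply/eqP/eq_from_tnth => i; rewrite !tnth_mktuple.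
by exists (@MkGA K n (nth_fun F, nth_fun F') P); split=> i; rewrite /GA_coord tnth_mktuple.
Qed.

(** A constant coordinate would make ['X_i] constant after applying [phi^-1]. Thus [affine] only
    requires an upper bound on the degrees. *)
Lemma msize_GA_coord phi i : (1 < msize (GA_coord phi i))%N.
Proof.
rewrite ltnNge; apply/negP => /msize1_polyC E.
have: msize ('X_i : {mpoly K[n]}) = 2%N by apply: msizeX1.
rewrite -(actK phi 'X_i) actX E comp_mpolyC => sz2.
by have := msizeCle n (GA_coord phi i)@_0%MM (ltn0Sn 0); rewrite sz2.
Qed.

Lemma affineP phi : affine phi <-> forall i, (msize (GA_coord phi i) <= 2)%N.
Proof.
split=> [aff i|sz i]; first by rewrite aff.
by apply/eqP; rewrite eqn_leq sz msize_GA_coord.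
Qed.

Lemma affine_comp phi p : affine phi -> (msize p <= 2)%N -> (msize (p \oo phi) <= 2)%N.
Proof. by move/affineP=> aff szp; apply: msize_comp_affine. Qed.

Lemma affineM phi psi : affine phi -> affine psi -> affine (phi * psi)%g.
Proof.
move=> /affineP a1 a2; apply/affineP => i; rewrite GA_coordM.
exact: affine_comp.
Qed.

Hypothesis K_char0 : [pchar K]%R =i pred0.

Lemma mderiv_eq0_supp r f : f^`M(r) = 0 -> forall m, m \in msupp f -> m r = 0%N.
Proof.
move=> fr m; rewrite mcoeff_msupp; case E: (m r) => [//|e] /negP[].
have: f^`M(r)@_(m - U_(r))%MM = 0 by rewrite fr mcoeff0.
rewrite mcoeff_deriv submK ?lep1mP ?E // mnmBE mnm1E eqxx E subn1 /= => /eqP.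
by rewrite -mulr_natr mulf_eq0 natf_eq0 // orbF.
Qed.

Lemma supp_mderiv_eq0 r f : (forall m, m \in msupp f -> m r = 0%N) -> f^`M(r) = 0.
Proof.
move=> H; apply/mpolyP => m; rewrite mcoeff_deriv mcoeff0.
case: (boolP ((m + U_(r))%MM \in msupp f)) => [/H|].
  by rewrite mnmDE mnm1E eqxx addn1.
by rewrite -mcoeff_eq0 => /eqP->; rewrite mul0rn.
Qed.

Lemma eq_comp_mpoly_off r f (F F' : n.-tuple {mpoly K[n]}) :
  f^`M(r) = 0 -> (forall i, i != r -> tnth F i = tnth F' i) ->
  f \mPo F = f \mPo F'.
Proof.
move=> fr FF'; rewrite (comp_mpolyEX f F) (comp_mpolyEX f F').
rewrite [LHS]big_seq [RHS]big_seq; apply: eq_bigr => m mf; congr (_ *: _).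
rewrite !comp_mpolyX; apply: eq_bigr => i _.
by have [->|/FF'->//] := eqVneq i r; rewrite (mderiv_eq0_supp fr mf) !expr0.
Qed.

Lemma comp_mpoly_off r f (F : n.-tuple {mpoly K[n]}) :
  f^`M(r) = 0 -> (forall i, i != r -> tnth F i = 'X_i) -> f \mPo F = f.
Proof.
move=> fr FX; rewrite -[RHS]comp_mpoly_id; apply: (eq_comp_mpoly_off fr) => i ir.
by rewrite FX // tnth_mktuple.
Qed.

(* The identity when f depends on x_r. *)
Definition elem_fun r f i : {mpoly K[n]} :=
  'X_i + (if (i == r) && (f^`M(r) == 0) then f else 0).

Lemma elem_funK r f i : elem_fun r f i \mPo nth_fun (elem_fun r (- f)) = 'X_i.
Proof.
rewrite /elem_fun comp_mpolyD comp_mpoly_fun mderivN oppr_eq0.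
case: ifP => [/andP[ir /eqP fr]|_]; last by rewrite comp_mpoly0 !addr0.
rewrite (comp_mpoly_off fr) ?addrNK // => j jr.
by rewrite tnth_mktuple (negPf jr) addr0.
Qed.

Fact elem_subproof r f :
  (endo_mul (nth_fun (elem_fun r f)) (nth_fun (elem_fun r (- f))) == endo_id K n) &&
  (endo_mul (nth_fun (elem_fun r (- f))) (nth_fun (elem_fun r f)) == endo_id K n).
Proof.
apply/andP; split; apply/eqP/eq_from_tnth => i; rewrite !tnth_mktuple.
  exact: elem_funK.
by have := elem_funK r (- f) i; rewrite opprK.
Qed.

Definition elem r f : GA K n :=
  @MkGA K n (nth_fun (elem_fun r f), nth_fun (elem_fun r (- f))) (elem_subproof r f).

Lemma GA_coord_elem r f i :
  f^`M(r) = 0 -> GA_coord (elem r f) i = 'X_i + f *+ (i == r).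
Proof.
by move=> fr; rewrite /GA_coord tnth_mktuple /elem_fun fr eqxx andbT; case: (i == r).
Qed.

Lemma act_elem_off r f p : p^`M(r) = 0 -> p \oo elem r f = p.
Proof.
move=> pr; apply: (comp_mpoly_off pr) => i ir.
by rewrite tnth_mktuple /elem_fun (negPf ir) addr0.
Qed.

Lemma elemD r f g : f^`M(r) = 0 -> g^`M(r) = 0 ->
  elem r (f + g) = (elem r f * elem r g)%g.
Proof.
move=> fr gr; apply: GA_coord_inj => i.
have fgr : (f + g)^`M(r) = 0 by rewrite mderivD fr gr addr0.
rewrite GA_coordM !GA_coord_elem // comp_mpolyD comp_mpolyMn actX act_elem_off //.
by rewrite GA_coord_elem // mulrnDl addrCA addrA [_ + 'X_i]addrC addrC addrCA addrA.
Qed.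

(* If chi^-1 d_r chi = mu^-1 d_k then chi conjugates the flow of g d_r into the
   flow of (g o chi) mu^-1 d_k. *)
Lemma elem_mul_conj chi k r (mu : K) g :
  g^`M(r) = 0 -> mu != 0 ->
  (forall i, (GA_coord chi i)^`M(k) = (mu *+ (i == r))%:MP) ->
  (g \oo chi)^`M(k) = 0 /\
  (elem r g * chi)%g = (chi * elem k (mu^-1 *: (g \oo chi)))%g.
Proof.
move=> gr mu0 chik; have h0 : (g \oo chi)^`M(k) = 0.
  rewrite (derivation_comp _ _ (derivation_mderiv K k)) big1 // => i _.
  have [->|ir] := eqVneq i r; first by rewrite gr comp_mpoly0 mul0r.
  by rewrite -[tnth _ _]/(GA_coord chi i) chik (negPf ir) mpolyC0 mulr0.
split=> //; set h := mu^-1 *: _.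
have hk : h^`M(k) = 0 by rewrite mderivZ h0 scaler0.
apply: GA_coord_inj => i; rewrite !GA_coordM GA_coord_elem // comp_mpolyD comp_mpolyMn actX.
have [->|ir] := eqVneq i r; last first.
  by rewrite mulr0n addr0 act_elem_off // chik (negPf ir) mpolyC0.
rewrite mulr1n; pose Q := GA_coord chi r - mu *: 'X_k.
have Qk : Q^`M(k) = 0.
  by rewrite mderivB mderivZ mderivXU eqxx chik eqxx mulr1n -mul_mpolyC mulr1 subrr.
have -> : GA_coord chi r = Q + mu *: 'X_k by rewrite subrK.
rewrite [RHS]comp_mpolyD comp_mpolyZ actX act_elem_off // GA_coord_elem // eqxx mulr1n.
by rewrite scalerDr scalerA mulfV // scale1r addrA.
Qed.

Lemma aff_exists (A : 'M[K]_n) (b : 'I_n -> K) : A \in unitmx ->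
  exists2 phi, affine phi & forall i,
    GA_coord phi i = \sum_j A i j *: 'X_j + (b i)%:MP.
Proof.
move=> uA; pose lin (B : 'M[K]_n) (c : 'I_n -> K) i : {mpoly K[n]} :=
  \sum_j B i j *: 'X_j + (c i)%:MP.
have linK (B C : 'M[K]_n) c d : B *m C = 1%:M ->
    (forall i, c i = - \sum_j B i j * d j) ->
    forall i, lin B c i \mPo nth_fun (lin C d) = 'X_i.
  move=> BC cd i; rewrite comp_mpolyD comp_mpolyC raddf_sum /=.
  under eq_bigr do rewrite comp_mpolyZ comp_mpoly_fun /lin scalerDr scaler_sumr.
  rewrite big_split exchange_big /= -addrA [X in _ + X](_ : _ = 0); last first.
    rewrite cd mpolyCN raddf_sum /=; apply/eqP; rewrite subr_eq0; apply/eqP.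
    by apply: eq_bigr => j _; rewrite mpolyCM mul_mpolyC.
  rewrite addr0 (bigD1 i) //= [X in _ + X]big1 => [|j ji].
    under eq_bigr do rewrite scalerA; rewrite -scaler_suml.
    by have /matrixP/(_ i i) := BC; rewrite !mxE eqxx => ->; rewrite scale1r addr0.
  under eq_bigr do rewrite scalerA; rewrite -scaler_suml.
  by have /matrixP/(_ i j) := BC; rewrite !mxE eq_sym (negPf ji) => ->; rewrite scale0r.
pose c i := - \sum_j invmx A i j * b j.
have [] := @GA_exists (lin A b) (lin (invmx A) c).
- apply: linK; first by rewrite mulmxV.
  move=> i; rewrite /c; under eq_bigr do rewrite mulrN; rewrite sumrN opprK.
  under eq_bigr do rewrite mulr_sumr; rewrite exchange_big (bigD1 i) //=.
  have /matrixP AV := mulmxV uA; rewrite [X in _ + X]big1 => [|j ji].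
    under eq_bigr do rewrite mulrA; rewrite -mulr_suml.
    by have := AV i i; rewrite !mxE eqxx => ->; rewrite mul1r addr0.
  under eq_bigr do rewrite mulrA; rewrite -mulr_suml.
  by have := AV i j; rewrite !mxE eq_sym (negPf ji) => ->; rewrite mul0r.
- by apply: linK => //; rewrite mulVmx.
move=> phi [E _]; exists phi => //; apply/affineP => i; rewrite E.
have sS := msize_subspace K n 2; apply: (subspaceD sS); last exact: msizeCle.
by apply: (subspace_sum _ sS) => j _; apply: (subspaceZ _ sS); rewrite msizeX1.
Qed.

End Automorphisms.

(** * Elementary automorphisms inside a group that contains the affine ones *)

Section Subgroup.

Variables (K : fieldType) (n : nat).
Hypothesis K_char0 : [pchar K]%R =i pred0.

Implicit Types (p q P f g : {mpoly K[n]}) (i j k r : 'I_n).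
Implicit Types (phi psi chi : GA K n).

Local Notation elem := (elem K_char0).

Definition affine_overgroup (G : GA K n -> Prop) :=
  [/\ forall phi, affine phi -> G phi,
      forall phi psi, G phi -> G psi -> G (phi * psi)%g
    & forall phi, G phi -> G phi^-1%g].

Variable G : GA K n -> Prop.
Hypothesis GG : affine_overgroup G.

Let Gaff phi : affine phi -> G phi. Proof. by case: GG => H _ _; exact: H. Qed.
Let GM phi psi : G phi -> G psi -> G (phi * psi)%g. Proof. by case: GG => _ H _; exact: H. Qed.
Let GV phi : G phi -> G phi^-1%g. Proof. by case: GG => _ _ H; exact: H. Qed.

Lemma affine_elem r f : (msize f <= 2)%N -> f^`M(r) = 0 -> affine (elem r f).
Proof.
move=> szf fr; apply/affineP => i; rewrite GA_coord_elem //.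
have sS := msize_subspace K n 2; apply: (subspaceD sS); first by rewrite msizeX1.
by case: (i == r) => //; rewrite mulr0n; case: sS.
Qed.

(** The first clause rules out the default value of [elem], the identity, taken when [f] depends on
    [x_r]. *)
Definition elem_in r f := f^`M(r) = 0 /\ G (elem r f).

Lemma elem_in_affine r f : (msize f <= 2)%N -> f^`M(r) = 0 -> elem_in r f.
Proof. by move=> szf fr; split=> //; apply/Gaff/affine_elem. Qed.

Lemma elem_in_conj chi k r (mu : K) g :
  G chi -> elem_in r g -> mu != 0 ->
  (forall i, (GA_coord chi i)^`M(k) = (mu *+ (i == r))%:MP) ->
  elem_in k (mu^-1 *: (g \oo chi)).
Proof.
move=> Gchi [gr Gg] mu0 chik.
have [gk E] := elem_mul_conj K_char0 gr mu0 chik.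
split; first by rewrite mderivZ gk scaler0.
rewrite (_ : elem k _ = chi^-1 * (elem r g * chi))%g; last by rewrite E mulKg.
exact: GM (GV Gchi) (GM Gg Gchi).
Qed.

Lemma elem_inD r f g : elem_in r f -> elem_in r g -> elem_in r (f + g).
Proof.
move=> [fr Gf] [gr Gg]; split; first by rewrite mderivD fr gr addr0.
by rewrite elemD //; apply: GM.
Qed.

Lemma diag_exists (u : 'I_n -> K) : (forall i, u i != 0) ->
  exists2 phi, affine phi & forall i, GA_coord phi i = u i *: 'X_i.
Proof.
move=> u0; pose A : 'M[K]_n := diag_mx (\row_i u i).
have uA : A \in unitmx.
  rewrite unitmxE det_diag unitfE; apply/prodf_neq0 => i _; by rewrite mxE.
have [phi aphi E] := aff_exists (fun=> 0) uA.
exists phi => // i; rewrite E mpolyC0 addr0 (bigD1 i) //= !mxE eqxx mulr1n big1 ?addr0 //.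
by move=> j ji; rewrite !mxE eq_sym (negPf ji) mulr0n scale0r.
Qed.

Lemma perm_exists (s : {perm 'I_n}) :
  exists2 phi : GA K n, affine phi & forall i, GA_coord phi i = 'X_(s i).
Proof.
have [phi aphi E] := aff_exists (fun=> 0) (unitmx_perm K s).
exists phi => // i; rewrite E mpolyC0 addr0 (bigD1 (s i)) //= !mxE eqxx scale1r big1 ?addr0 //.
by move=> j ji; rewrite !mxE eq_sym (negPf ji) scale0r.
Qed.

Lemma elem_inZ r (c : K) f : elem_in r f -> elem_in r (c *: f).
Proof.
move=> Vf; have [->|c0] := eqVneq c 0.
  by rewrite scale0r; apply: elem_in_affine; rewrite ?msize0 ?mderiv0.
(* The map [x_r -> c^-1 x_r] fixes [f], which is free of [x_r], and conjugation by it multiplies [f]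
   by [c]. *)
have [|chi achi E] := @diag_exists (fun i => if i == r then c^-1 else 1).
  by move=> i; case: ifP => _; rewrite ?invr_eq0 ?oner_eq0.
have := @elem_in_conj chi r r c^-1 f (Gaff achi) Vf; rewrite invrK invr_eq0 => /(_ c0).
rewrite (@comp_mpoly_off _ _ K_char0 r); first apply.
- move=> i; rewrite E mderivZ mderivXU.
  by case: eqP => _; rewrite ?scaler0 ?mulr0n ?mpolyC0 // -mul_mpolyC mulr1.
- by case: Vf.
- by move=> i ir; rewrite -[tnth _ _]/(GA_coord chi i) E (negPf ir) scale1r.
Qed.

Lemma elem_in_subspace r : subspace (elem_in r).
Proof.
split; first by apply: elem_in_affine; rewrite ?msize0 ?mderiv0.
by move=> c p q Vp Vq; apply: elem_inD => //; apply: elem_inZ.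
Qed.

Lemma elem_in_conj1 chi k r g :
  G chi -> elem_in r g ->
  (forall i, (GA_coord chi i)^`M(k) = ((i == r)%:R)%:MP) ->
  elem_in k (g \oo chi).
Proof.
move=> Gchi Vg chik; rewrite -[_ \oo _]scale1r -(invr1 K).
by apply: elem_in_conj => //; rewrite ?oner_eq0.
Qed.

(* Differentiates at 0 the conjugates of x_k -> x_k + g by a polynomial family of
   automorphisms of G. *)
Lemma elem_in_first_order k g (F : 'I_n -> {poly {mpoly K[n]}}) :
  elem_in k g ->
  (forall i, (F i)`_0 = 'X_i) ->
  (forall a : nat, exists chi, [/\ G chi, forall i, GA_coord chi i = (F i).[a%:R]
    & exists2 mu : K, mu != 0 &
      forall i, (GA_coord chi i)^`M(k) = (mu *+ (i == k))%:MP]) ->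
  elem_in k (\sum_i g^`M(i) * (F i)`_1).
Proof.
move=> Vg F0 Fa.
have := @subspace_first_order _ _ K_char0 (elem_in k) g F (elem_in_subspace k).
have -> : nth_fun (fun i => (F i)`_0) = endo_id K n.
  by apply: eq_from_tnth => j; rewrite !tnth_mktuple F0.
rewrite (eq_bigr (fun i => g^`M(i) * (F i)`_1)) => [|i _]; last first.
  by rewrite comp_mpoly_id.
apply=> a; have [chi [Gchi chiE [mu mu0 chik]]] := Fa a.
have := elem_in_conj Gchi Vg mu0 chik; move/(elem_inZ mu).
rewrite scalerA mulfV // scale1r; congr (elem_in k (g \mPo _)).
by apply: eq_from_tnth => i; rewrite tnth_mktuple -chiE.
Qed.

(** This is the first-order term of the conjugates under the affine shears [x_i -> x_i + a h]. *)
Lemma elem_in_shear k i (h : {mpoly K[n]}) f :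
  (msize h <= 2)%N -> i != k -> h^`M(i) = 0 -> h^`M(k) = 0 ->
  elem_in k f -> elem_in k (f^`M(i) * h).
Proof.
move=> szh ik hi hk Vf.
pose F j : {poly {mpoly K[n]}} := ('X_j)%:P + (h *+ (j == i)) *: 'X.
have -> : f^`M(i) * h = \sum_j f^`M(j) * (F j)`_1.
  rewrite (bigD1 i) //= big1 => [|j ji]; rewrite coefD coefC coefZ coefX /= ?eqxx ?mulr1 ?add0r ?addr0 //.
  by rewrite (negPf ji) mulr0n ?mul0r mulr0.
apply: elem_in_first_order => // [j|a].
  by rewrite coefD coefC coefZ coefX /= mulr0 addr0.
have aE : (a%:R : {mpoly K[n]}) = (a%:R : K)%:MP by rewrite mpolyC_nat.
have ahi : ((a%:R : K) *: h)^`M(i) = 0 by rewrite mderivZ hi scaler0.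
exists (elem i (a%:R *: h)); split.
- by apply/Gaff/affine_elem => //; rewrite (leq_trans (msizeZ_le _ _)).
- move=> j; rewrite GA_coord_elem // /F !hornerE aE.
  by case: (j == i); rewrite ?mulr1n ?mulr0n ?mul0r // mulrC mul_mpolyC.
exists 1; first by rewrite oner_eq0.
move=> j; rewrite GA_coord_elem // mderivD mderivXU mderivMn mderivZ hk scaler0 mul0rn addr0.
by case: (j == k); rewrite ?mpolyC0 ?mpolyC1.
Qed.

Lemma elem_in_mderiv k i f : elem_in k f -> elem_in k f^`M(i).
Proof.
move=> Vf; have [->|ik] := eqVneq i k.
  by case: Vf => -> _; case: (elem_in_subspace k).
rewrite -[f^`M(i)]mulr1; apply: elem_in_shear => //; rewrite -mpolyC1 ?mderivC //.
exact: msizeCle.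
Qed.

Lemma elem_in_move k i j f : i != k -> j != k -> elem_in k f -> elem_in k (f^`M(i) * 'X_j).
Proof.
move=> ik jk Vf; have [->|ji] := eqVneq j i; last first.
  by apply: elem_in_shear => //; rewrite ?msizeX1 // mderivXU ?(negPf ji) ?(negPf jk).
(* For [j = i] the shear gives way to the dilation [x_i -> (1 + a) x_i], invertible at every natural
   number [a]. *)
pose F l : {poly {mpoly K[n]}} := ('X_l)%:P + ('X_i *+ (l == i)) *: 'X.
have -> : f^`M(i) * 'X_i = \sum_j f^`M(j) * (F j)`_1.
  rewrite (bigD1 i) //= big1 => [|l li]; rewrite coefD coefC coefZ coefX /= ?eqxx ?mulr1 ?add0r ?addr0 //.
  by rewrite (negPf li) mulr0n ?mul0r mulr0.
apply: elem_in_first_order => // [l|a].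
  by rewrite coefD coefC coefZ coefX /= mulr0 addr0.
have aE : (a%:R : {mpoly K[n]}) = (a%:R : K)%:MP by rewrite mpolyC_nat.
have [|chi achi E] := @diag_exists (fun l => if l == i then a.+1%:R else 1).
  by move=> l; case: ifP => _; rewrite ?natf_eq0 ?oner_eq0.
exists chi; split; first exact: Gaff.
- move=> l; rewrite E /F !hornerE aE; case: eqP => [->|_].
    by rewrite mulr1n mulrC mul_mpolyC -natr1 scalerDl scale1r addrC.
  by rewrite mulr0n mul0r addr0 scale1r.
exists 1; first by rewrite oner_eq0.
move=> l; rewrite E mderivZ mderivXU.
case: (eqVneq l k) => [->|_]; last by rewrite scaler0 mpolyC0.
by rewrite eq_sym (negPf ik) scale1r mpolyC1.
Qed.

End Subgroup.

(** * Tame automorphisms from one nonaffine elementary automorphism *)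

Section Tame.

Variables (K : fieldType) (n : nat).
Hypothesis K_char0 : [pchar K]%R =i pred0.

Implicit Types (p q P f g : {mpoly K[n]}) (i j k r : 'I_n) (m : 'X_{1..n}).
Implicit Types (phi psi chi : GA K n).

Local Notation elem := (elem K_char0).

Lemma mderivX_mulX m i j :
  'X_[K, m]^`M(i) * 'X_j = (m i)%:R *: 'X_[m - U_(i) + U_(j)].
Proof. by rewrite mderivX -scalerAl -mpolyXD. Qed.

(** The operator [x_i d_i] is diagonal in the monomial basis; its eigenvalues serve to separate the
    monomials of [f]. *)
Lemma mcoeff_mderiv_mulX f i m : (f^`M(i) * 'X_i)@_m = (m i)%:R * f@_m.
Proof.
elim/mpolyind: f => [|c m' f _ _ IHf]; first by rewrite mderiv0 mul0r mcoeff0 mulr0.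
rewrite mderivD mulrDl mcoeffD IHf mcoeffD mulrDr; congr (_ + _).
rewrite mderivZ -scalerAl mderivX_mulX scalerA !mcoeffZ !mcoeffX.
have [->|m'm] := eqVneq m' m.
  case: (posnP (m i)) => [->|mi]; first by rewrite mulr0 !mul0r.
  by rewrite submK ?lep1mP -?lt0n // eqxx !mulr1 mulrC.
rewrite !mulr0; case: (posnP (m' i)) => [->|mi]; first by rewrite mulr0 mul0r.
by rewrite submK ?lep1mP -?lt0n // (negPf m'm) mulr0.
Qed.

Lemma eq_mnm_le_mdeg m1 m2 :
  (forall i, (m1 i <= m2 i)%N) -> mdeg m1 = mdeg m2 -> m1 = m2.
Proof.
move=> le12; rewrite !mdegE => E; apply/mnmP => i; apply/eqP.
have [_ /esym] := leqif_sum (fun i (_ : true) => leqif_eq (le12 i)).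
by rewrite E eqxx => /forallP/(_ i).
Qed.

Lemma mnm_moveE m i j l :
  (m - U_(i) + U_(j))%MM l = (m l - (i == l) + (j == l))%N.
Proof. by rewrite mnmDE mnmBE !mnm1E. Qed.

Variable G : GA K n -> Prop.
Hypothesis GG : affine_overgroup G.

Local Notation elem_in := (elem_in K_char0 G).

(** If another monomial [m'] of [f] differs from [m] in the exponent of [x_i], then [x_i d_i - m' i]
    kills [m'], keeps [m] and preserves [elem_in k]. Induction on the number of monomials. *)
Lemma elem_in_monomial k f m : elem_in k f -> m \in msupp f -> elem_in k 'X_[m].
Proof.
have sV := elem_in_subspace K_char0 GG k.
move: {2}(size (msupp f)) (leqnn (size (msupp f))) => N.
elim: N f => [|N IHN] f szf Vf mf.
  by move: szf; rewrite leqn0 => /nilP E; rewrite E in mf.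
have [/hasP[m' m'f m'm]|/hasPn H] := boolP (has (predC1 m) (msupp f)); last first.
  have fE : f = f@_m *: 'X_[m].
    apply/mpolyP => m'; rewrite mcoeffZ mcoeffX; have [<-|m'm] := eqVneq m m'.
      by rewrite mulr1.
    rewrite mulr0; apply/eqP; rewrite mcoeff_eq0; apply/negP => /H /=.
    by rewrite eq_sym m'm.
  have := subspaceZ (f@_m)^-1 sV Vf; rewrite {2}fE scalerA mulVf ?scale1r //.
  by rewrite -mcoeff_msupp.
have [i mi] : exists i, m' i != m i.
  apply/existsP; rewrite -negb_forall; apply: contra m'm => /forallP E.
  by apply/eqP/mnmP => i; apply/eqP.
have fk : f^`M(k) = 0 by case: Vf.
have ik : i != k.
  by apply: contraNneq mi => ->; rewrite (mderiv_eq0_supp K_char0 fk mf)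
    (mderiv_eq0_supp K_char0 fk m'f).
pose f' := f^`M(i) * 'X_i - (m' i)%:R *: f.
have f'E m1 : f'@_m1 = ((m1 i)%:R - (m' i)%:R) * f@_m1.
  by rewrite mcoeffB mcoeff_mderiv_mulX mcoeffZ mulrBl.
apply: (IHN f').
- rewrite -ltnS (leq_trans _ szf) //.
  have : (size (m' :: msupp f') <= size (msupp f))%N; last by [].
  apply: uniq_leq_size; first by rewrite /= msupp_uniq mcoeff_msupp f'E subrr mul0r eqxx.
  move=> m1; rewrite inE => /orP[/eqP->//|]; rewrite !mcoeff_msupp f'E.
  by apply: contraNneq => ->; rewrite mulr0.
- by apply: (subspaceB sV); [apply: elem_in_move|apply: (subspaceZ _ sV)].
rewrite mcoeff_msupp f'E mulf_neq0 -?mcoeff_msupp // subr_eq0.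
move: mi; case: (ltngtP (m' i) (m i)) => // lt _.
  by rewrite -subr_eq0 -natrB ?natf_eq0 ?subn_eq0 -?ltnNge // ltnW.
by rewrite eq_sym -subr_eq0 -natrB ?natf_eq0 ?subn_eq0 -?ltnNge // ltnW.
Qed.

(** The operator [x_j d_i] moves one unit of exponent from [x_i] to [x_j]. With [i] in excess and
    [j] in deficit, the degree of the truncated difference [m - m'] drops. *)
Lemma elem_in_same_degree k m m' :
  mdeg m = mdeg m' -> m k = 0%N -> m' k = 0%N ->
  elem_in k 'X_[m] -> elem_in k 'X_[m'].
Proof.
have sV := elem_in_subspace K_char0 GG k.
move: {2}(mdeg (m - m')%MM) (leqnn (mdeg (m - m')%MM)) => N.
elim: N m => [|N IHN] m leN dmm' mk m'k Vm.
  rewrite -(@eq_mnm_le_mdeg m m') // => i; rewrite -subn_eq0 -mnmBE.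
  by move: leN; rewrite leqn0 mdeg_eq0 => /eqP->; rewrite mnm0E.
have [/eqP<-//|nmm'] := boolP (m == m').
have /existsP[i lti] : [exists i, m' i < m i]%N.
  apply: contraNT nmm'; rewrite negb_exists => /forallP H.
  by apply/eqP/eq_mnm_le_mdeg => // i; have := H i; rewrite -leqNgt.
have /existsP[j ltj] : [exists j, m j < m' j]%N.
  apply: contraNT nmm'; rewrite negb_exists => /forallP H.
  rewrite eq_sym; apply/eqP/eq_mnm_le_mdeg => // l; have := H l; rewrite -leqNgt //.
have ik : i != k by apply: contraTneq lti => ->; rewrite mk.
have jk : j != k by apply: contraTneq ltj => ->; rewrite m'k.
have ij : j != i by apply: contraTneq ltj => ->; rewrite -leqNgt ltnW.
have U1 : (U_(i) <= m)%MM by rewrite lep1mP -lt0n (leq_trans _ lti).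
apply: (IHN (m - U_(i) + U_(j))%MM).
- rewrite -ltnS (leq_trans _ leN) // !mdegE (bigD1 i) //= [ltnRHS](bigD1 i) //=.
  rewrite -addSn leq_add //.
    rewrite mnmBE mnm_moveE mnmBE eqxx (negPf ij) addn0 subn1 -subSn.
      by rewrite prednK // (leq_trans _ lti).
    by rewrite -ltnS prednK // (leq_trans _ lti).
  apply: leq_sum => l li; rewrite mnmBE mnm_moveE mnmBE eq_sym (negPf li) subn0.
  have [<-|_] := eqVneq j l; last by rewrite addn0.
  by rewrite addn1 (eqP (_ : _ - _ == 0)%N) // subn_eq0.
- by rewrite mdegD mdeg1 -dmm' -[in RHS](submK U1) mdegD mdeg1.
- by rewrite mnm_moveE mk sub0n (negPf jk).
- exact: m'k.
have := subspaceZ ((m i)%:R^-1) sV (elem_in_move GG ik jk Vm).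
rewrite mderivX_mulX scalerA mulVf ?scale1r //.
by rewrite natf_eq0 // -lt0n (leq_trans _ lti).
Qed.

(** The leading monomial of [f] has degree at least two; derivatives bring it down to exactly
    two. *)
Lemma elem_in_quadratic k f : elem_in k f -> (2 < msize f)%N ->
  exists m, [/\ mdeg m = 2%N, m k = 0%N & elem_in k 'X_[m]].
Proof.
have sV := elem_in_subspace K_char0 GG k.
move=> Vf szf; have fk : f^`M(k) = 0 by case: Vf.
have f0 : f != 0 by apply: contraTneq szf => ->; rewrite msize0.
have : (1 < mdeg (mlead f))%N by rewrite -ltnS mlead_deg.
have Vm := elem_in_monomial Vf (mlead_supp f0).
have := mderiv_eq0_supp K_char0 fk (mlead_supp f0).
move: (mlead f) Vm => m; have [N] := ubnP (mdeg m).
elim: N m => // N IHN m ltN Vm mk gt1.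
have [E|ne2] := eqVneq (mdeg m) 2%N; first by exists m.
have /existsP[i mi] : [exists i, m i != 0%N].
  apply: contraTT gt1; rewrite negb_exists => /forallP H.
  by rewrite mdegE big1 // => i _; apply/eqP; have := H i; rewrite negbK.
have ik : i != k by apply: contraNneq mi => ->; rewrite mk.
have dm : mdeg m = (mdeg (m - U_(i))).+1.
  by rewrite -[in LHS](@submK _ U_(i)%MM m) ?lep1mP // mdegD mdeg1 addn1.
apply: (IHN (m - U_(i))%MM).
- by move: ltN; rewrite dm.
- have := subspaceZ ((m i)%:R^-1) sV (elem_in_mderiv GG i Vm).
  by rewrite mderivX scalerA mulVf ?scale1r // natf_eq0.
- by rewrite mnmBE mk.
by move: gt1 ne2; rewrite dm; case: (mdeg _) => [|[]].
Qed.

Hypothesis n_ge3 : (3 <= n)%N.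

Lemma ord_neq2 k r : exists i, (i != k) && (i != r).
Proof.
apply/existsP; apply: contraLR n_ge3; rewrite negb_exists => /forallP H.
rewrite -ltnNge -[X in (X < _)%N]card_ord ltnS.
apply: (leq_trans (subset_leq_card (_ : _ \subset [set k; r]))).
  by apply/subsetP => i _; have := H i; rewrite -negb_or negbK !inE.
by rewrite cards2; case: (k == r).
Qed.

(** The square of a variable other than [x_k] is reached in direction [k], the transposition of [k]
    and [r] carries it to direction [r], and moving exponents gives the rest. *)
Lemma elem_in_all_quadratic k f : elem_in k f -> (2 < msize f)%N ->
  forall r m, mdeg m = 2%N -> m r = 0%N -> elem_in r 'X_[m].
Proof.
move=> Vf szf r m dm mr; have [m1 [dm1 m1k V1]] := elem_in_quadratic Vf szf.
have [a /andP[ak _]] := ord_neq2 k k.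
have Va : elem_in k 'X_[U_(a) + U_(a)].
  apply: elem_in_same_degree V1 => //; first by rewrite mdegD mdeg1 dm1.
  by rewrite mnmDE mnm1E (negPf ak).
have [chi achi chiE] := perm_exists K (tperm k r).
have Gchi : G chi by case: GG => H _ _; apply: H.
have := @elem_in_conj1 _ _ K_char0 G GG chi r k _ Gchi Va.
rewrite mpolyXD comp_mpolyM actX chiE -mpolyXD => V.
apply: (@elem_in_same_degree r (U_(tperm k r a) + U_(tperm k r a))%MM) => //.
- by rewrite mdegD mdeg1 dm.
- rewrite mnmDE mnm1E; case: eqP => // /(congr1 (tperm k r)).
  by rewrite tpermK tpermR => /eqP; rewrite (negPf ak).
apply: V => i; rewrite chiE mderivXU mpolyC_nat; congr (_%:R); congr (nat_of_bool _).
by rewrite -(inj_eq (@perm_inj _ (tperm k r))) tpermK tpermR.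
Qed.

Lemma elem_in_all k f : elem_in k f -> (2 < msize f)%N ->
  forall r g, g^`M(r) = 0 -> elem_in r g.
Proof.
move=> Vf szf.
have Vm d r m : (1 < d)%N -> mdeg m = d -> m r = 0%N -> elem_in r 'X_[m].
  elim: d r m => [//|d IHd] r m; rewrite ltnS leq_eqVlt => /orP[/eqP<-|d1] dm mr.
    exact: (elem_in_all_quadratic Vf szf).
  have [i /andP[ir _]] := ord_neq2 r r; have [l /andP[lr li]] := ord_neq2 r i.
  have Vh : elem_in l 'X_[U_(i) *+ d].
    apply: IHd => //; first by rewrite mdegMn mdeg1 mul1n.
    by rewrite mulmnE mnm1E eq_sym (negPf li).
  have Vli : elem_in r 'X_[U_(l) + U_(i)].
    apply: (elem_in_all_quadratic Vf szf); first by rewrite mdegD !mdeg1.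
    by rewrite mnmDE !mnm1E (negPf lr) (negPf ir).
  have sV := elem_in_subspace K_char0 GG r.
  have [hl Gh] := Vh; set h := 'X_[_] in hl Gh Vh.
  have hr : h^`M(r) = 0.
    by rewrite mderivX mulmnE mnm1E (negPf ir) scale0r.
  have lir : ('X_i : {mpoly K[n]})^`M(l) = 0 by rewrite mderivXU eq_sym (negPf li).
  (* Conjugation turns [x_l x_i] into [(x_l + x_i^d) x_i], and subtracting [x_l x_i] leaves
     [x_i^(d+1)]. The three indices [r], [i], [l] are distinct. *)
  have := elem_in_conj1 (k := r) GG Gh Vli.
  rewrite mpolyXD comp_mpolyM !actX !GA_coord_elem // eqxx mulr1n eq_sym (negPf li) mulr0n addr0.
  move=> V; have {}V := subspaceB sV (V _) Vli.
  apply: (@elem_in_same_degree r (U_(i) *+ d + U_(i))%MM) => //.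
  - by rewrite mdegD mdegMn !mdeg1 mul1n addn1 dm.
  - by rewrite mnmDE mulmnE !mnm1E (negPf ir).
  have := V; rewrite mpolyXD mulrDl addrC addKr -mpolyXD; apply=> j.
  rewrite GA_coord_elem // mderivD mderivXU mderivMn hr mul0rn addr0.
  by rewrite mpolyC_nat.
move=> r g gr; rewrite [g]mpolyE big_seq_cond.
have sV := elem_in_subspace K_char0 GG r.
apply: (subspace_sum _ sV) => m /andP[mg _]; apply: (subspaceZ _ sV).
have mr := mderiv_eq0_supp K_char0 gr mg.
have [d1|] := leqP (mdeg m) 1; last by move/Vm => /(_ r m erefl mr).
apply: elem_in_affine => //; first by rewrite msizeX.
by rewrite mderivX mr scale0r.
Qed.

Lemma tame_sub k f : elem_in k f -> (2 < msize f)%N -> forall psi, tame psi -> G psi.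
Proof.
move=> Vf szf; have Vall := elem_in_all Vf szf.
have [Gaff GM GV] := GG.
(* The coordinates from [d] on are trivial; the induction peels off the last nontrivial one. *)
have Gunitri d psi (P : 'I_n -> {mpoly K[n]}) :
    (forall i, in_vars_below i (P i)) ->
    (forall i, GA_coord psi i = 'X_i + (if (i < d)%N then P i else 0)) -> G psi.
  move=> PB; elim: d psi => [|d IHd] psi E.
    apply: Gaff; apply/affineP => i.
    by rewrite E /= addr0 msizeX1.
  have [nd|dn] := leqP n d.
    apply: IHd => i; rewrite E.
    by rewrite !(leq_trans (ltn_ord i)) // ltnW.
  pose k' := Ordinal dn; have Pk : (P k')^`M(k') = 0.
    by apply: supp_mderiv_eq0 => m mP; apply: (PB k').
  have nPk : (- P k')^`M(k') = 0 by rewrite mderivN Pk oppr0.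
  have [_ GP] := Vall k' (P k') Pk; have [_ GnP] := Vall k' (- P k') nPk.
  (* Composing on the right with [x_d -> x_d - P_d] cancels [P_d] and fixes the earlier coordinates,
     which are free of [x_d]. *)
  rewrite -(mulgK (elem k' (- P k')) psi); apply: GM; last exact: GV.
  apply: IHd => i; rewrite GA_coordM E comp_mpolyD actX GA_coord_elem //.
  have [ik|ki] := ltnP i d.
    have ik' : i != k' by rewrite -val_eqE /= ltn_eqF.
    rewrite ltnS (ltnW ik) (negPf ik') mulr0n addr0 act_elem_off //.
    apply: supp_mderiv_eq0 => m mP; apply: (PB i) => //=; exact: ltnW.
  have [<-|ik'] := eqVneq k' i.
    by rewrite mulr1n /= ltnSn act_elem_off // addrNK addr0.
  rewrite mulr0n addr0 ltnS leqNgt ltn_neqAle ki andbT.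
  by rewrite (_ : (d == i :> nat) = (k' == i)) // (negPf ik') /= comp_mpoly0 ?addr0.
have Gtri psi : triangular psi -> G psi.
  case=> u [P H]; have u0 i : (u i)^-1 != 0 by case: (H i) => ? _ _; rewrite invr_eq0.
  have [chi achi chiE] := diag_exists u0.
  rewrite -(mulKg chi psi); apply: GM; first exact/GV/Gaff.
  apply: (Gunitri n _ (fun i => (u i)^-1 *: P i)) => i.
    case: (H i) => _ B _ m /msuppZ_le; exact: B.
  case: (H i) => ui0 _ E.
  by rewrite GA_coordM chiE comp_mpolyZ actX E ltn_ord scalerDr scalerA mulVf // scale1r.
move=> psi; elim=> [chi [/Gaff//|/Gtri//]||x y _ Gx _ Gy|x _ Gx].
- by apply: Gaff; apply/affineP => i; rewrite GA_coord1 msizeX1.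
- exact: GM.
- exact: GV.
Qed.

End Tame.

(** * The derivation D and its flows in G *)

Section Conjugates.

Variables (K : fieldType) (n : nat).
Hypothesis K_char0 : [pchar K]%R =i pred0.

Implicit Types (p q P f g w : {mpoly K[n]}) (i j k r : 'I_n).
Implicit Types (phi psi chi B : GA K n).

Local Notation elem := (elem K_char0).

Definition pull_deriv phi r p := (p \oo phi^-1%g)^`M(r) \oo phi.

Lemma derivation_pull phi r : derivation (pull_deriv phi r).
Proof.
split=> [c|p q|p q]; rewrite /pull_deriv.
- by rewrite comp_mpolyC mderivC comp_mpoly0.
- by rewrite comp_mpolyD mderivD comp_mpolyD.
- by rewrite comp_mpolyM mderivM comp_mpolyD !comp_mpolyM !actVK.
Qed.

Lemma pull_deriv_coord phi r i : pull_deriv phi r (GA_coord phi i) = (i == r)%:R%:MP.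
Proof. by rewrite /pull_deriv -actX actK mderivXU -mpolyC_nat comp_mpolyC. Qed.

Lemma pull_deriv_mul phi B r p :
  pull_deriv (phi * B)%g r (p \oo B) = pull_deriv phi r p \oo B.
Proof. by rewrite /pull_deriv invgM !actM actK. Qed.

(** The conjugations telescope, so the local nilpotency of [d_r] passes to its conjugate. *)
Lemma iter_pull_deriv phi r d p :
  iter d (pull_deriv phi r) p = iter d (mderiv r) (p \oo phi^-1%g) \oo phi.
Proof.
by elim: d => [|d IHd]; rewrite ?actVK // !iterS IHd /pull_deriv actK.
Qed.

Variable G : GA K n -> Prop.
Hypothesis GG : affine_overgroup G.

Local Notation elem_in := (elem_in K_char0 G).

Let Gaff phi : affine phi -> G phi. Proof. by case: GG => H _ _; exact: H. Qed.
Let GM phi psi : G phi -> G psi -> G (phi * psi)%g. Proof. by case: GG => _ H _; exact: H. Qed.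
Let GV phi : G phi -> G phi^-1%g. Proof. by case: GG => _ _ H; exact: H. Qed.

(** The common target of all the cases below: [tame_sub] then puts every tame automorphism in
    [G]. *)
Definition nonaffine_elem_in := exists k f, elem_in k f /\ (2 < msize f)%N.

(* chi conjugates x_r -> x_r + x_i into x_k -> x_k + chi_i; if all these chi_i are
   affine then chi_r = x_k - P and x_k -> x_k + P makes chi affine. *)
Lemma straightened chi k r :
  G chi -> ~ affine chi ->
  (forall i, (GA_coord chi i)^`M(k) = (i == r)%:R%:MP) ->
  nonaffine_elem_in.
Proof.
move=> Gchi nchi chik.
have [/existsP[i /andP[ir szi]]|/existsPn H] :=
    boolP [exists i, (i != r) && (2 < msize (GA_coord chi i))%N].
  exists k, (GA_coord chi i); split=> //; rewrite -actX.
  apply: (elem_in_conj1 GG Gchi _ chik); apply: elem_in_affine => //.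
    by rewrite msizeX1.
  by rewrite mderivXU (negPf ir).
have {}H i : i != r -> (msize (GA_coord chi i) <= 2)%N.
  by move=> ir; have := H i; rewrite ir /= -leqNgt.
pose P := 'X_k - GA_coord chi r.
have Pk : P^`M(k) = 0.
  by rewrite mderivB mderivXU chik !eqxx mpolyC_nat subrr.
have sS := msize_subspace K n 2.
exists k, P; split; last first.
  rewrite ltnNge; apply/negP => szP; apply: nchi; apply/affineP => i.
  have [->|/H//] := eqVneq i r.
  by rewrite -[GA_coord _ _](subKr 'X_k); apply: (subspaceB sS) => //; rewrite msizeX1.
split=> //; rewrite -(mulKg chi (elem k P)); apply: GM; first exact: GV.
apply: Gaff; apply/affineP => i; rewrite GA_coordM.
have [->|ir] := eqVneq i r; last first.
  by rewrite act_elem_off ?H // chik (negPf ir) mpolyC_nat.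
rewrite -[GA_coord chi r](subKr 'X_k) -/P comp_mpolyB actX GA_coord_elem // eqxx mulr1n.
by rewrite act_elem_off // addrK msizeX1.
Qed.

(* For g killed by D = pull_deriv phi r this says that phi^-1 (x_r + g o phi^-1) phi,
   the time-one map of g D, lies in G. *)
Definition flow_in phi r g := elem_in r (g \oo phi^-1%g).

Section Flow.

Variables (phi : GA K n) (r : 'I_n).
Hypothesis Gphi : G phi.

Local Notation D := (pull_deriv phi r).
Local Notation W := (flow_in phi r).

Lemma flow_in_subspace : subspace W.
Proof.
have [V0 VD] := elem_in_subspace K_char0 GG r.
split; first by rewrite /flow_in comp_mpoly0.
by move=> c p q Vp Vq; rewrite /flow_in comp_mpolyD comp_mpolyZ; apply: VD.
Qed.

Lemma flow_in_coord i : i != r -> W (GA_coord phi i).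
Proof.
move=> ir; rewrite /flow_in -actX actK; apply: elem_in_affine => //.
  by rewrite msizeX1.
by rewrite mderivXU (negPf ir).
Qed.

(** By the chain rule the hypothesis on coordinates extends to [D (p o B) = mu (D p) o B] for all
    [p]. Hence [phi B phi^-1] scales [d_r] by [mu], and [elem_in_conj] applies to it with
    [k = r]. *)
Lemma flow_in_conj B (mu : K) g :
  G B -> mu != 0 -> (forall i, D (GA_coord B i) = mu *: (D 'X_i \oo B)) ->
  W g -> W (g \oo B).
Proof.
move=> GB mu0 DB Wg; have DcB p : D (p \oo B) = mu *: (D p \oo B).
  rewrite (derivation_comp _ _ (derivation_pull phi r)).
  rewrite (derivationE p (derivation_pull phi r)) comp_mpoly_sum scaler_sumr.
  apply: eq_bigr => i _; rewrite -[tnth _ _]/(GA_coord B i) DB /= comp_mpolyM.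
  by rewrite scalerAr.
have Gchi : G (phi * B * phi^-1)%g by apply: GM; [apply: GM|apply: GV].
have := @elem_in_conj _ _ K_char0 _ GG (phi * B * phi^-1)%g r r mu _ Gchi Wg mu0.
rewrite !actM actVK => V; rewrite -(scale1r (g \oo B)) -(mulfV mu0) -scalerA.
apply: (subspaceZ _ flow_in_subspace); rewrite /flow_in comp_mpolyZ; apply: V => i.
rewrite !GA_coordM; have := DcB (GA_coord phi i); rewrite pull_deriv_coord comp_mpolyC.
move=> /(congr1 (fun p => p \oo phi^-1%g)); rewrite /pull_deriv actK => ->.
by rewrite comp_mpolyZ comp_mpolyC -mul_mpolyC -mpolyCM mulr_natr.
Qed.

Lemma flow_in_first_order g (F : 'I_n -> {poly {mpoly K[n]}}) :
  W g -> (forall i, (F i)`_0 = 'X_i) ->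
  (forall a : nat, exists B, [/\ G B, forall i, GA_coord B i = (F i).[a%:R]
    & exists2 mu : K, mu != 0 &
      forall i, D (GA_coord B i) = mu *: (D 'X_i \oo B)]) ->
  W (\sum_i g^`M(i) * (F i)`_1).
Proof.
move=> Wg F0 Fa.
have := @subspace_first_order _ _ K_char0 W g F flow_in_subspace.
have -> : nth_fun (fun i => (F i)`_0) = endo_id K n.
  by apply: eq_from_tnth => j; rewrite !tnth_mktuple F0.
rewrite (eq_bigr (fun i => g^`M(i) * (F i)`_1)) => [|i _]; last first.
  by rewrite comp_mpoly_id.
apply=> a; have [B [GB BE [mu mu0 DB]]] := Fa a.
have := flow_in_conj GB mu0 DB Wg; congr (flow_in _ _ (g \mPo _)).
by apply: eq_from_tnth => i; rewrite tnth_mktuple -BE.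
Qed.

Definition flow g : GA K n := (phi^-1 * elem r (g \oo phi^-1) * phi)%g.

Lemma flow_in_elem g : W g -> G (flow g).
Proof. by case=> _ Gg; apply: GM => //; apply: GM => //; apply: GV. Qed.

Lemma GA_coord_elem_mul g i : W g ->
  GA_coord (elem r (g \oo phi^-1) * phi)%g i = GA_coord phi i + g *+ (i == r).
Proof.
case=> gr _; rewrite GA_coordM GA_coord_elem // comp_mpolyD actX comp_mpolyMn.
by rewrite actVK.
Qed.

(** If all these flows were affine, the first-order term [g * D p] of [p] along them would have
    degree at most one, but it is a product of two nonconstant polynomials. *)
Lemma flow_nonaffine g p :
  W g -> (1 < msize g)%N -> (msize p <= 2)%N -> (1 < msize (D p))%N ->
  exists c : K, ~ affine (flow (c *: g)).
Proof.
move=> Wg szg szp szDp; apply: NNPP => nex.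
have H (c : K) : affine (flow (c *: g)) by apply: NNPP => naff; apply: nex; exists c.
(* At [c] this path is [phi * flow (c *: g)], so substituting it into [p o phi^-1] gives [p] along
   the flow. *)
pose F i : {poly {mpoly K[n]}} := (GA_coord phi i)%:P + (g *+ (i == r)) *: 'X.
have := @subspace_first_order _ _ K_char0 _ (p \oo phi^-1%g) F (msize_subspace K n 2).
have -> : nth_fun (fun i => (F i)`_0) = GA_endo phi.
  by apply: eq_from_tnth => i; rewrite tnth_mktuple coefD coefC coefZ coefX mulr0 addr0.
rewrite (bigD1 r) //= big1 ?addr0 => [|i ir]; last first.
  by rewrite coefD coefC coefZ coefX (negPf ir) /= add0r mul0r mulr0.
rewrite coefD coefC coefZ coefX eqxx /= add0r mulr1 -/(D p) => szDg.
suff: (msize (D p * g) <= 2)%N.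
  have Dp0 : D p != 0 by rewrite -msize_poly_eq0 -lt0n ltnW.
  have g0 : g != 0 by rewrite -msize_poly_eq0 -lt0n ltnW.
  rewrite msizeM //; move: szg szDp; case: (msize g) => [|[|a]] //.
  by case: (msize (D p)) => [|[|b]] // _ _; rewrite addSn /= !addnS.
apply: szDg => a; have aE : (a%:R : {mpoly K[n]}) = (a%:R : K)%:MP by rewrite mpolyC_nat.
have Wag : W (a%:R *: g) by apply: (subspaceZ _ flow_in_subspace).
have -> : nth_fun (fun i => (F i).[a%:R]) = GA_endo (elem r ((a%:R *: g) \oo phi^-1) * phi)%g.
  apply: eq_from_tnth => i; rewrite -[RHS]/(GA_coord _ i) GA_coord_elem_mul //.
  rewrite tnth_mktuple /F !hornerE aE.
  by case: (i == r); rewrite ?mulr1n ?mulr0n ?mul0r // mulrC mul_mpolyC.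
by rewrite -actM mulgA; apply: affine_comp (H _) szp.
Qed.

(* The flow of c g D commutes with the translations along x_k. *)
Lemma commuting_direction k g p :
  (forall q, (D q)^`M(k) = D q^`M(k)) ->
  W g -> g^`M(k) = 0 -> (1 < msize g)%N ->
  (msize p <= 2)%N -> (1 < msize (D p))%N -> nonaffine_elem_in.
Proof.
move=> Dk Wg gk szg szp szDp.
have [c naff] := flow_nonaffine Wg szg szp szDp.
have Wcg : W (c *: g) by apply: (subspaceZ _ flow_in_subspace).
apply: (straightened (flow_in_elem Wcg) naff (k := k) (r := k)) => i.
rewrite /flow -mulgA GA_coordM; set tau := (_ * phi)%g.
set Q := GA_coord phi^-1%g i.
(* These are the coefficients of [d_k] in the coordinates [H_j]. As [d_k] commutes with [D], they
   are free of [x_r], so the elementary factor of [tau] fixes them. *)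
pose a j := (GA_coord phi j)^`M(k) \oo phi^-1%g.
have ar j : (a j)^`M(r) = 0.
  rewrite -[LHS](actK phi) -/(D _) -Dk pull_deriv_coord mderivC.
  by rewrite comp_mpoly0.
have atau j : a j \oo tau = (GA_coord phi j)^`M(k).
  by rewrite /tau actM act_elem_off // actVK.
rewrite (derivation_comp _ _ (derivation_mderiv K k)).
rewrite (eq_bigr (fun j => (Q^`M(j) * a j) \oo tau)) => [|j _]; last first.
  rewrite comp_mpolyM atau -[tnth _ _]/(GA_coord tau j) /tau GA_coord_elem_mul //.
  by rewrite mderivD mderivMn mderivZ gk scaler0 mul0rn addr0.
rewrite -comp_mpoly_sum (_ : \sum_j _ = (i == k)%:R%:MP) ?comp_mpolyC //.
(* The same sum arises without the elementary factor, where it is [d_k] of [Q o phi = x_i]. *)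
have := derivation_comp Q (GA_endo phi) (derivation_mderiv K k).
rewrite /Q -actX actVK mderivXU -mpolyC_nat => /(congr1 (fun p => p \oo phi^-1%g)).
rewrite comp_mpolyC => ->; rewrite comp_mpoly_sum; apply: eq_bigr => j _ /=.
by rewrite comp_mpolyM actK.
Qed.

End Flow.

Lemma flow_in_mul phi B r g : flow_in phi r g -> flow_in (phi * B)%g r (g \oo B).
Proof. by rewrite /flow_in invgM actM actK. Qed.

(** [B] is the linear map whose matrix is the identity with its [k]-th column replaced by [u]. *)
Lemma straighten_exists (u : 'I_n -> K) k : u k != 0 ->
  exists B, [/\ affine B, affine B^-1%g &
    forall p, (p \oo B)^`M(k) = (\sum_i u i *: p^`M(i)) \oo B].
Proof.
move=> uk.
pose F i : {mpoly K[n]} := if i == k then u k *: 'X_k else 'X_i + u i *: 'X_k.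
pose F' i : {mpoly K[n]} :=
  if i == k then (u k)^-1 *: 'X_k else 'X_i - (u i / u k) *: 'X_k.
have [i|i|B [BE BVE]] := @GA_exists _ _ F F'.
- rewrite /F; case: eqP => [->|/eqP ik].
    by rewrite comp_mpolyZ comp_mpoly_fun /F' eqxx scalerA mulfV ?scale1r.
  rewrite comp_mpolyD comp_mpolyZ !comp_mpoly_fun /F' eqxx (negPf ik).
  by rewrite scalerA subrK.
- rewrite /F'; case: eqP => [->|/eqP ik].
    by rewrite comp_mpolyZ comp_mpoly_fun /F eqxx scalerA mulVf ?scale1r.
  rewrite comp_mpolyB comp_mpolyZ !comp_mpoly_fun /F eqxx (negPf ik).
  by rewrite scalerA -mulrA mulVf // mulr1 addrK.
have sS := msize_subspace K n 2.
exists B; split.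
- apply/affineP => i; rewrite BE /F.
  case: ifP => _; first by apply: (subspaceZ _ sS); rewrite msizeX1.
  by apply: (subspaceD sS); [|apply: (subspaceZ _ sS)]; rewrite msizeX1.
- apply/affineP => i; rewrite BVE /F'.
  case: ifP => _; first by apply: (subspaceZ _ sS); rewrite msizeX1.
  by apply: (subspaceB sS); [|apply: (subspaceZ _ sS)]; rewrite msizeX1.
move=> p; rewrite (derivation_comp _ _ (derivation_mderiv K k)) comp_mpoly_sum.
apply: eq_bigr => i _; rewrite comp_mpolyZ -[tnth _ _]/(GA_coord B i) BE /F.
rewrite mulrC -[RHS]mul_mpolyC; congr (_ * _); case: eqP => [->|/eqP ik].
  by rewrite mderivZ mderivXU eqxx -mul_mpolyC mulr1.
by rewrite mderivD mderivZ !mderivXU eqxx (negPf ik) add0r -mul_mpolyC mulr1.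
Qed.

(** Here [D] is the derivative along a constant vector, nonzero since [D H_r = 1]; a linear map
    turns it into some [d_k]. *)
Lemma constant_direction phi r :
  G phi -> ~ affine phi -> (forall i, (msize (pull_deriv phi r 'X_i) <= 1)%N) ->
  nonaffine_elem_in.
Proof.
move=> Gphi nphi DX; pose u i := (pull_deriv phi r 'X_i)@_0%MM.
have uE i : pull_deriv phi r 'X_i = (u i)%:MP by apply: msize1_polyC.
have DE p : pull_deriv phi r p = \sum_i u i *: p^`M(i).
  rewrite (derivationE p (derivation_pull phi r)); apply: eq_bigr => i _.
  by rewrite uE mulrC mul_mpolyC.
have [/existsP[k uk]|/existsPn u0] := boolP [exists k, u k != 0]; last first.
  have /eqP := pull_deriv_coord phi r r; rewrite DE big1.
    by rewrite eqxx eq_sym mpolyC_nat oner_eq0.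
  by move=> i _; have := u0 i; rewrite negbK => /eqP ->; rewrite scale0r.
have [B [aB aBV BE]] := straighten_exists uk.
apply: (@straightened (phi * B)%g k r).
- by apply: GM => //; apply: Gaff.
- by move=> aphiB; apply: nphi; rewrite -(mulgK B phi); apply: affineM.
by move=> i; rewrite GA_coordM BE -DE pull_deriv_coord comp_mpolyC.
Qed.

(** Straightening [u] to the direction of [x_k] reduces this to [commuting_direction]. *)
Lemma kernel_direction phi r (u : 'I_n -> K) k g p :
  G phi -> u k != 0 ->
  (forall q, \sum_i u i *: (pull_deriv phi r q)^`M(i) =
             pull_deriv phi r (\sum_i u i *: q^`M(i))) ->
  flow_in phi r g -> \sum_i u i *: g^`M(i) = 0 -> (1 < msize g)%N ->
  (msize p <= 2)%N -> (1 < msize (pull_deriv phi r p))%N -> nonaffine_elem_in.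
Proof.
move=> Gphi uk Du Wg gu szg szp szDp; have [B [aB aBV BE]] := straighten_exists uk.
have szB q : (1 < msize q)%N -> (1 < msize (q \oo B))%N.
  rewrite !ltnNge; apply: contra => /msize1_polyC E.
  by rewrite -(actK B q) E comp_mpolyC msizeCle.
apply: (@commuting_direction (phi * B)%g r _ k (g \oo B) (p \oo B)).
- by apply: GM => //; apply: Gaff.
- move=> q; have [q' ->] : exists q', q = q' \oo B.
    by exists (q \oo B^-1%g); rewrite actVK.
  by rewrite pull_deriv_mul !BE Du -pull_deriv_mul.
- exact: flow_in_mul.
- by rewrite BE gu comp_mpoly0.
- exact: szB.
- exact: affine_comp.
- by rewrite pull_deriv_mul szB.
Qed.

End Conjugates.

(** * The case D x_0 = a, D x_i = x_(i-1) *)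

Section Chain.

Variables (K : fieldType) (n : nat).
Hypothesis K_char0 : [pchar K]%R =i pred0.

Implicit Types (p q P f g w : {mpoly K[n]}) (i j k : 'I_n).
Implicit Types (phi psi chi B : GA K n).

Local Notation elem := (elem K_char0).

Variable G : GA K n -> Prop.
Hypothesis GG : affine_overgroup G.
Variables (phi : GA K n) (r : 'I_n).
Hypothesis Gphi : G phi.

Local Notation D := (pull_deriv phi r).
Local Notation W := (flow_in K_char0 G phi r).

Variables (z s l : 'I_n) (a : K).
Hypotheses (z0 : z = 0%N :> nat) (sn : s.+2 = n) (ln : l.+1 = n).
Hypothesis n_ge3 : (3 <= n)%N.
Hypothesis a0 : a != 0.
Hypothesis DXz : D 'X_z = a%:MP.
Hypothesis DXS : forall i j, j = i.+1 :> nat -> D 'X_j = 'X_i.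

Let ls : l = s.+1 :> nat. Proof. by apply: succn_inj; rewrite ln sn. Qed.
Let sl : s != l. Proof. by rewrite -val_eqE /= ls ltn_eqF. Qed.
Let zl : z != l. Proof. by rewrite -val_eqE /= z0 -eqSS ln ltn_eqF // (ltn_trans _ n_ge3). Qed.
Let zs : z != s. Proof. by rewrite -val_eqE /= z0 -2!eqSS sn ltn_eqF. Qed.

Let DXl : D 'X_l = 'X_s.
Proof. exact: DXS ls. Qed.

(** The booleans stand for [i == z] and [i == l]. The clause [j != l] records that no [D x_i]
    involves the last variable. *)
Variant chain_spec i : bool -> bool -> {mpoly K[n]} -> Prop :=
| ChainZ of i = z : chain_spec i true false a%:MP
| ChainS j of i = j.+1 :> nat & j != l : chain_spec i false (j == s) 'X_j.

Lemma chainP i : chain_spec i (i == z) (i == l) (D 'X_i).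
Proof.
case E: (nat_of_ord i) => [|i'].
  have -> : i = z by apply: val_inj; rewrite /= E z0.
  by rewrite eqxx (negPf zl) DXz; constructor.
have lt : (i' < n)%N by rewrite (ltn_trans _ (ltn_ord i)) // E.
rewrite (DXS (i := Ordinal lt)) //.
rewrite -!val_eqE /= E z0 /= (_ : (i'.+1 == l) = (Ordinal lt == s)).
  constructor => //; rewrite -val_eqE /= -eqSS ln ltn_eqF //.
  by rewrite -E.
by rewrite -[RHS]val_eqE /= ls eqSS.
Qed.

(* D maps x_0 -> a and x_i -> x_(i-1). The fields d_l and E commute with D, and D is
   homogeneous of degree -1 for the grading of the Euler field Eu; each of them
   integrates to affine automorphisms normalising D, hence preserves W. *)
Let e i : {mpoly K[n]} :=
  if i == s then 1 else if i == l then a^-1 *: 'X_z else 0.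
Local Notation E := (vfield e).
Local Notation Eu := (vfield (fun i => i.+1%:R *: 'X_i)).

Let dD := derivation_pull phi r.
Let dl := derivation_mderiv K l.
Let dE := derivation_vfield e.
Let dEu := derivation_vfield (fun i => i.+1%:R *: 'X_i : {mpoly K[n]}).

Lemma chain_mderiv_comm p : (D p)^`M(l) = D p^`M(l).
Proof.
apply/eqP; rewrite -subr_eq0; apply/eqP.
apply: (derivation_bracket dl dD (derivation_zero K n)) => i /=.
rewrite mderivXU (derivation_nat _ dD) subr0.
by case: chainP => [_|j _ jl]; rewrite ?mderivC // mderivXU (negPf jl).
Qed.

Lemma chain_mderivE p : (E p)^`M(l) = E p^`M(l).
Proof.
apply/eqP; rewrite -subr_eq0; apply/eqP.
apply: (derivation_bracket dl dE (derivation_zero K n)) => i /=.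
rewrite mderivXU (derivation_nat _ dE) subr0 vfieldX /e.
case: ifP => _; first by rewrite -mpolyC1 mderivC.
by case: ifP => _; rewrite ?mderiv0 // mderivZ mderivXU (negPf zl) scaler0.
Qed.

(** The variable [x_l] has weight [n], so [d_l] lowers weights by [n]. *)
Lemma chain_mderivEu p : (Eu p)^`M(l) = Eu p^`M(l) + n%:R *: p^`M(l).
Proof.
apply/eqP; rewrite addrC -subr_eq; apply/eqP.
apply: (derivation_bracket dl dEu (derivation_scale n%:R dl)) => i /=.
rewrite mderivXU (derivation_nat _ dEu) subr0 vfieldX mderivZ mderivXU.
by case: eqP => [->|_]; rewrite ?scaler0 // ln.
Qed.

(** Both terms [d_s] and [a^-1 x_0 d_l] of [E] lower weights by [n - 1], since [x_0], [x_s] and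
    [x_l] have weights [1], [n - 1] and [n]. *)
Lemma chain_EEu p : E (Eu p) = Eu (E p) + n.-1%:R *: E p.
Proof.
apply/eqP; rewrite addrC -subr_eq; apply/eqP.
apply: (derivation_bracket dE dEu (derivation_scale n.-1%:R dE)) => i /=.
have Eu1 : Eu 1 = 0 := derivation_nat 1 dEu.
rewrite !vfieldX (derivationZ _ _ dE) vfieldX /e; case: eqP => [->|_].
  by rewrite Eu1 subr0 (congr1 predn (esym sn) : n.-1 = s.+1).
case: eqP => [->|_]; last by rewrite (derivation0 dEu) !scaler0 subr0.
rewrite (derivationZ _ _ dEu) vfieldX z0 scale1r ln.
have -> : n%:R = n.-1%:R + 1 :> K by rewrite natr1 prednK // (ltnW (ltnW n_ge3)).
by rewrite scalerDl scale1r addrK.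
Qed.

Let Gaff B : affine B -> G B. Proof. by case: GG => H _ _; exact: H. Qed.

Let linfam (b : 'I_n -> {mpoly K[n]}) i : {poly {mpoly K[n]}} := ('X_i)%:P + b i *: 'X.

Let flow_vfield (b : 'I_n -> {mpoly K[n]}) g :
  (forall c : K, exists B, [/\ G B, forall i, GA_coord B i = 'X_i + c *: b i
    & forall i, D (GA_coord B i) = D 'X_i \oo B]) ->
  W g -> W (vfield b g).
Proof.
move=> Hb Wg; rewrite /vfield.
rewrite (eq_bigr (fun i => g^`M(i) * (linfam b i)`_1)) => [|i _]; last first.
  by rewrite /linfam coefD coefC coefZ coefX /= mulr1 add0r.
apply: (flow_in_first_order GG Gphi Wg) => [i|m].
  by rewrite /linfam coefD coefC coefZ coefX /= mulr0 addr0.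
have [B [GB BE DB]] := Hb m%:R; exists B; split=> //.
  move=> i; rewrite BE /linfam !hornerE -mul_mpolyC mpolyC_nat.
  by rewrite [_ * b i]mulrC.
by exists 1 => [|i]; rewrite ?oner_eq0 // scale1r.
Qed.

Lemma chain_flow_mderiv g : W g -> W g^`M(l).
Proof.
move=> Wg; have -> : g^`M(l) = vfield (fun i => (i == l)%:R) g.
  by rewrite (derivationE g dl); apply: eq_bigr => i _; rewrite mderivXU.
apply: flow_vfield Wg => c; exists (elem l c%:MP).
have cl : (c%:MP : {mpoly K[n]})^`M(l) = 0 by rewrite mderivC.
split.
- by apply/Gaff/affine_elem => //; apply: msizeCle.
- move=> i; rewrite GA_coord_elem //.
  by case: (i == l); rewrite ?scaler0 // -mul_mpolyC mulr1.
move=> i; rewrite GA_coord_elem //; case: (dD) => DC DD _.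
rewrite DD -mulr_natr -mpolyC_nat -mpolyCM DC addr0 act_elem_off //.
by rewrite chain_mderiv_comm mderivXU (derivation_nat _ dD).
Qed.

(** As [z != s], [E] kills [x_0]; so the exponential of [c E] is the affine map [x_s -> x_s + c],
    [x_l -> x_l + (c / a) x_0], which commutes with [D]. *)
Lemma chain_flowE g : W g -> W (E g).
Proof.
move=> Wg; apply: flow_vfield Wg => c; pose h : {mpoly K[n]} := (c / a) *: 'X_z.
have hl : h^`M(l) = 0 by rewrite mderivZ mderivXU (negPf zl) scaler0.
have cs : (c%:MP : {mpoly K[n]})^`M(s) = 0 by rewrite mderivC.
have BE i : GA_coord (elem s c%:MP * elem l h)%g i = 'X_i + c *: e i.
  rewrite GA_coordM !GA_coord_elem // comp_mpolyD comp_mpolyMn comp_mpolyC actX.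
  rewrite GA_coord_elem // /e; case: (eqVneq i s) => [->|_].
    by rewrite (negPf sl) addr0 -mul_mpolyC mulr1.
  by case: (eqVneq i l) => _; rewrite !addr0 ?scaler0 ?addr0 // scalerA.
exists (elem s c%:MP * elem l h)%g; split=> //.
  case: GG => _ GM _; apply: GM; apply/Gaff/affine_elem => //; first exact: msizeCle.
  by rewrite (leq_trans (msizeZ_le _ _)) // msizeX1.
move=> i; rewrite BE; case: (dD) => DC DD _; rewrite DD (derivationZ _ _ dD) /e.
case: (chainP i) => [->|j ij jl]; rewrite ?comp_mpolyC ?actX.
  by rewrite (negPf zs) (derivation0 dD) scaler0 addr0.
rewrite BE /e (negPf jl); case: (eqVneq j s) => [js|_].
  have -> : i = l by apply: val_inj; rewrite /= ij js; rewrite ls.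
  rewrite eq_sym (negPf sl) (derivationZ _ _ dD) DXz.
  by rewrite scalerA -mul_mpolyC -mpolyCM divfK // -mul_mpolyC mulr1.
by case: ifP => _; rewrite -?mpolyC1 ?DC ?(derivation0 dD) !scaler0.
Qed.

(** The dilations [x_i -> (1 + t)^(i+1) x_i] scale [D] by [1 + t] and have velocity [Eu] at
    [t = 0]. *)
Lemma chain_flowEu g : W g -> W (Eu g).
Proof.
move=> Wg; pose F i : {poly {mpoly K[n]}} := 'X_i *: (1 + 'X) ^+ i.+1.
have F1 d : ((1 + 'X : {poly {mpoly K[n]}}) ^+ d)`_0 = 1 /\
            ((1 + 'X : {poly {mpoly K[n]}}) ^+ d)`_1 = d%:R.
  elim: d => [|d [IH0 IH1]]; first by rewrite expr0 !coefC.
  rewrite exprS mulrDl mul1r !coefD !coefXM /= IH0 IH1 addr0.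
  by rewrite -natr1.
rewrite /vfield (eq_bigr (fun i => g^`M(i) * (F i)`_1)) => [|i _]; last first.
  rewrite /F coefZ (F1 i.+1).2 -mul_mpolyC mpolyC_nat.
  by rewrite ['X_i * _]mulrC.
apply: (flow_in_first_order GG Gphi Wg) => [i|m].
  by rewrite /F coefZ (F1 i.+1).1 mulr1.
have t0 : m.+1%:R != 0 :> K by rewrite natf_eq0.
have [|B aB BE] := @diag_exists K n (fun i => m.+1%:R ^+ i.+1).
  by move=> i; rewrite expf_neq0.
exists B; split; first exact: Gaff.
  move=> i; rewrite BE /F !hornerE -mul_mpolyC rmorphXn /= mpolyC_nat.
  by rewrite mulrC -natr1 [1 + _]addrC.
exists m.+1%:R => // i; rewrite BE (derivationZ _ _ dD).
case: (chainP i) => [->|j ij _].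
  by rewrite comp_mpolyC z0 expr1.
by rewrite actX BE scalerA -exprS ij.
Qed.

Lemma chain_iterEu d p :
  iter d (mderiv l) (Eu p) = Eu (iter d (mderiv l) p) + (d * n)%:R *: iter d (mderiv l) p.
Proof.
elim: d => [|d IHd]; first by rewrite mul0n scale0r addr0.
rewrite !iterS IHd mderivD chain_mderivEu mderivZ -addrA -scalerDl.
by rewrite -natrD mulSn.
Qed.

Lemma chain_flow_iter d g : W g -> W (iter d (mderiv l) g).
Proof. by move=> Wg; elim: d => //= d; apply: chain_flow_mderiv. Qed.

Lemma chain_iterE d p : iter d (mderiv l) (E p) = E (iter d (mderiv l) p).
Proof. by elim: d => //= d ->; rewrite chain_mderivE. Qed.

Lemma iter_mderivB k d p q :
  iter d (mderiv k) (p - q) = iter d (mderiv k) p - iter d (mderiv k) q.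
Proof. by elim: d => //= d ->; rewrite mderivB. Qed.

Lemma iter_mderivZ k d c p : iter d (mderiv k) (c *: p) = c *: iter d (mderiv k) p.
Proof. by elim: d => //= d ->; rewrite mderivZ. Qed.

Lemma last_nonzero_iter k d p : p != 0 -> iter d (mderiv k) p = 0 ->
  exists2 d', (d' < d)%N & iter d' (mderiv k) p != 0 /\ (iter d' (mderiv k) p)^`M(k) = 0.
Proof.
move=> p0; elim: d => [/eqP|d IHd E]; first by rewrite (negPf p0).
have [/IHd[d' lt H]|N] := eqVneq (iter d (mderiv k) p) 0.
  by exists d' => //; apply: ltnW.
by exists d.
Qed.

(* Let c be the last nonzero d_l-derivative of w, of order d + 1. If c is constant then
   Eu w - (d + 1) n w has smaller degree in x_l, and if E kills it then E w is an
   eigenvector of Eu whose last nonzero d_l-derivative has positive weight, so it is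
   not constant. *)
Lemma chain_descent d w : W w -> iter d.+1 (mderiv l) w = 0 -> E w != 0 ->
  exists g, [/\ W g, (1 < msize g)%N & g^`M(l) = 0].
Proof.
elim: d w => [|d IHd] w Ww wd Ew.
  exists w; split=> //; rewrite ltnNge; apply: contra Ew => /msize1_polyC ->.
  by case: dE => EC _ _; rewrite EC.
have sW := flow_in_subspace K_char0 GG phi r.
set c := iter d.+1 (mderiv l) w; have Wc : W c by apply: chain_flow_iter.
have [c1|/msize1_polyC cE] := ltnP 1 (msize c); first by exists c.
pose w' := Eu w - (d.+1 * n)%:R *: w.
have Ww' : W w' by apply: (subspaceB sW); [apply: chain_flowEu|apply: subspaceZ].
have w'd : iter d.+1 (mderiv l) w' = 0.
  rewrite iter_mderivB chain_iterEu iter_mderivZ addrK -/c cE.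
  by case: dEu => EC _ _; rewrite EC.
have [Ew'|/(IHd _ Ww' w'd)//] := eqVneq (E w') 0.
have EuEw : Eu (E w) = (d.+1 * n)%:R *: E w - n.-1%:R *: E w.
  apply/eqP; rewrite eq_sym subr_eq; apply/eqP.
  have [_ ED _] := dE; move: Ew'; rewrite /w' ED (derivationN _ dE) (derivationZ _ _ dE).
  by rewrite chain_EEu => /eqP; rewrite subr_eq0 => /eqP.
have Ewd : iter d.+1 (mderiv l) (E w) = 0.
  by rewrite chain_iterE -/c cE; case: dE => EC _ _; rewrite EC.
have [d' ltd' [g0 gl]] := last_nonzero_iter Ew Ewd.
exists (iter d' (mderiv l) (E w)); split=> //.
  by apply: chain_flow_iter; apply: chain_flowE.
rewrite ltnNge; apply/negP => /msize1_polyC gE; move: g0.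
have := chain_iterEu d' (E w); rewrite EuEw iter_mderivB !iter_mderivZ.
rewrite {3}gE; have [EC _ _] := dEu; rewrite EC add0r => /eqP.
rewrite -scalerBl -subr_eq0 -scalerBl scaler_eq0 => /orP[|->//].
(* The weight [(d + 1) n - (n - 1) - d' n] is at least 1 because [d' <= d], whereas a nonzero
   constant has weight 0. *)
have le1 : (d'.+1 * n <= d.+1 * n)%N by rewrite leq_mul2r ltd' orbT.
have -> : (d.+1 * n)%:R - n.-1%:R - (d' * n)%:R = (d.+1 * n - (d' * n + n.-1))%:R :> K.
  rewrite natrB; first by rewrite natrD opprD addrA addrAC.
  by rewrite (leq_trans _ le1) // mulSn addnC leq_add2r leq_pred.
rewrite natf_eq0 // subn_eq0 leqNgt (leq_trans _ le1) //.
by rewrite mulSn addnC ltn_add2r ltn_predL (ltnW (ltnW n_ge3)).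
Qed.

Lemma chain_direction : nonaffine_elem_in K_char0 G.
Proof.
have [i ir Ei] : exists2 i, i != r & E (GA_coord phi i) != 0.
  apply/exists_inP; apply: contraT => /exists_inPn H.
  (* If [E] kills every other [H_i], then [E = (E H_r) D]. At [x_0], where [E] vanishes and [D] is
     [a], this yields [E H_r = 0], against [E x_s = 1]. *)
  have EE p : E p = D p * E (GA_coord phi r).
    rewrite -[p in LHS](actVK phi) (derivation_comp _ _ dE) (bigD1 r) //=.
    rewrite big1 ?addr0 // => i ir.
    by have := H i ir; rewrite negbK -[tnth _ _]/(GA_coord phi i) => /eqP->; rewrite mulr0.
  have Er0 : E (GA_coord phi r) = 0.
    have := EE 'X_z; rewrite vfieldX /e (negPf zs) (negPf zl) DXz mul_mpolyC.
    by move/esym/eqP; rewrite scaler_eq0 (negPf a0) => /eqP.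
  have := EE 'X_s; rewrite Er0 mulr0 vfieldX /e eqxx => /eqP.
  by rewrite oner_eq0.
have Wi := flow_in_coord K_char0 GG phi ir.
have := @chain_descent (msize (GA_coord phi i)) _ Wi _ Ei.
case=> [|g [Wg szg gl]]; first exact/iter_mderiv_eq0/leqnSn.
apply: (commuting_direction GG Gphi chain_mderiv_comm Wg gl szg (p := 'X_l)).
  by rewrite msizeX1.
by rewrite DXl msizeX1.
Qed.

End Chain.

(** * The linear part of D *)

Section LinearPart.

Variables (K : fieldType) (n : nat).
Hypothesis K_char0 : [pchar K]%R =i pred0.
Hypothesis n_ge3 : (3 <= n)%N.

Implicit Types (p q g w : {mpoly K[n]}) (i j k : 'I_n).
Implicit Types (phi psi B : GA K n).

Variable G : GA K n -> Prop.
Hypothesis GG : affine_overgroup G.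
Variables (phi : GA K n) (r : 'I_n).
Hypothesis Gphi : G phi.
Hypothesis nphi : ~ affine phi.

Local Notation D := (pull_deriv phi r).
Local Notation W := (flow_in K_char0 G phi r).

Hypothesis DX : forall i, (msize (D 'X_i) <= 2)%N.

Let dD := derivation_pull phi r.
Let Gaff B : affine B -> G B. Proof. by case: GG => H _ _; exact: H. Qed.

Definition linear_part p : 'rV[K]_n := \row_j p@_U_(j).

(** Linear parts are row vectors, so [D] acts on them by right multiplication by this matrix. *)
Definition linear_mx : 'M[K]_n := \matrix_(i, j) (D 'X_i)@_U_(j).

Local Notation N := linear_mx.

Lemma mulmx_expD m (x : 'M[K]_(m, n)) (A : 'M[K]_n) d e :
  x *m A ^+ d *m A ^+ e = x *m A ^+ (d + e).
Proof. by rewrite exprD mulmxA. Qed.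

Lemma DX_E i : D 'X_i = ((D 'X_i)@_0%MM)%:MP + \sum_j N i j *: 'X_j.
Proof.
rewrite {1}(affine_mpolyE (DX i)); congr (_ + _).
by apply: eq_bigr => j _; rewrite mxE.
Qed.

Lemma D_affineE p : (msize p <= 2)%N -> D p = \sum_i p@_U_(i) *: D 'X_i.
Proof.
move=> szp; have [DC DD _] := dD.
rewrite {1}(affine_mpolyE szp) DD DC add0r (derivation_sum _ _ _ dD).
by apply: eq_bigr => i _; rewrite (derivationZ _ _ dD).
Qed.

Lemma D_affine p : (msize p <= 2)%N -> (msize (D p) <= 2)%N.
Proof.
move=> szp; rewrite D_affineE //; have sS := msize_subspace K n 2.
by apply: (subspace_sum _ sS) => i _; apply: (subspaceZ _ sS).
Qed.

Lemma linear_part_D p : (msize p <= 2)%N -> linear_part (D p) = linear_part p *m N.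
Proof.
move=> szp; apply/rowP => j; rewrite D_affineE // !mxE raddf_sum /=.
by apply: eq_bigr => i _; rewrite mcoeffZ !mxE.
Qed.

Lemma iter_D_affine d p : (msize p <= 2)%N ->
  (msize (iter d D p) <= 2)%N /\ linear_part (iter d D p) = linear_part p *m N ^+ d.
Proof.
move=> szp; elim: d => [|d [IH1 IH2]]; first by rewrite expr0 mulmx1.
split; first exact: D_affine.
by rewrite iterS linear_part_D // IH2 exprSr -mulmxA.
Qed.

Lemma linear_partX i : linear_part 'X_i = delta_mx 0 i.
Proof. by apply/rowP => j; rewrite !mxE mcoeffXU eq_sym. Qed.

Lemma linear_mx_nilpotent : exists d, N ^+ d == 0.
Proof.
(* This many applications of [d_r] kill all the ['X_i \oo phi^-1] at once. *)
exists (\max_i msize ('X_i \oo phi^-1%g)); apply/eqP/row_matrixP => i.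
rewrite row0 rowE -linear_partX; set d := (\max_i _)%N.
have [|_ <-] := @iter_D_affine d 'X_i; first by rewrite msizeX1.
rewrite iter_pull_deriv iter_mderiv_eq0 ?comp_mpoly0.
  by apply/rowP => j; rewrite !mxE mcoeff0.
exact: (@leq_bigmax _ (fun i => msize ('X_i \oo phi^-1%g)) i).
Qed.

Definition dirderiv (v : 'rV[K]_n) p := \sum_i v 0 i *: p^`M(i).

Lemma derivation_dirderiv v : derivation (dirderiv v).
Proof.
have [C D' M] := derivation_vfield (fun i => (v 0 i)%:MP : {mpoly K[n]}).
have E p : dirderiv v p = vfield (fun i => (v 0 i)%:MP) p.
  by apply: eq_bigr => i _; rewrite mulrC mul_mpolyC.
by split=> [c|p q|p q]; rewrite !E.
Qed.

Lemma dirderivX v i : dirderiv v 'X_i = (v 0 i)%:MP.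
Proof.
rewrite /dirderiv (bigD1 i) //= mderivXU eqxx big1 => [|j ji].
  by rewrite addr0 -mul_mpolyC mulr1.
by rewrite mderivXU eq_sym (negPf ji) scaler0.
Qed.

(** The commutator takes [x_i] to the [i]-th entry of [v *m N^T]. *)
Lemma dirderiv_comm v q : v *m N^T = 0 -> dirderiv v (D q) = D (dirderiv v q).
Proof.
move=> vN; have [DC _ _] := dD; have dv := derivation_dirderiv v.
apply/eqP; rewrite -subr_eq0; apply/eqP.
apply: (derivation_bracket dv dD (derivation_zero K n)) => i.
rewrite dirderivX DC subr0 DX_E; have [VC VD _] := dv.
rewrite VD VC add0r (derivation_sum _ _ _ dv).
rewrite (eq_bigr (fun j => (v 0 j * N^T j i)%:MP)) => [|j _]; last first.
  by rewrite (derivationZ _ _ dv) dirderivX [N^T j i]mxE -mul_mpolyC -mpolyCM mulrC.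
rewrite -raddf_sum /= (_ : \sum_j _ = 0) ?mpolyC0 //.
by have /rowP/(_ i) := vN; rewrite !mxE.
Qed.

(** For [v] in the kernel of [N], the translations along [v] commute with [D]. *)
Lemma flow_in_dirderiv v g : v *m N^T = 0 -> W g -> W (dirderiv v g).
Proof.
move=> vN Wg; pose F i : {poly {mpoly K[n]}} := ('X_i)%:P + (v 0 i)%:MP *: 'X.
have -> : dirderiv v g = \sum_i g^`M(i) * (F i)`_1.
  apply: eq_bigr => i _; rewrite /F coefD coefC coefZ coefX /= mulr1 add0r.
  by rewrite mulrC mul_mpolyC.
apply: (flow_in_first_order GG Gphi Wg) => [i|a].
  by rewrite /F coefD coefC coefZ coefX /= mulr0 addr0.
have [B aB BE] := aff_exists (fun i => a%:R * v 0 i) (unitmx1 K n).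
have {}BE i : GA_coord B i = 'X_i + (a%:R * v 0 i)%:MP.
  rewrite BE (bigD1 i) //= mxE eqxx scale1r big1 ?addr0 // => j ji.
  by rewrite mxE eq_sym (negPf ji) scale0r.
exists B; split; first exact: Gaff.
  by move=> i; rewrite BE /F !hornerE mpolyCM mpolyC_nat mulrC.
exists 1 => [|i]; first by rewrite oner_eq0.
have [DC DD _] := dD; rewrite BE DD DC addr0 scale1r.
rewrite DX_E comp_mpolyD comp_mpolyC comp_mpoly_sum; congr (_ + _).
rewrite [RHS](eq_bigr (fun j => N i j *: 'X_j + (a%:R * (v 0 j * N^T j i))%:MP)).
  rewrite big_split /= [X in _ + X](_ : _ = 0) ?addr0 //.
  rewrite -raddf_sum -mulr_sumr /= (_ : \sum_j _ = 0) ?mulr0 ?mpolyC0 //.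
  by have /rowP/(_ i) := vN; rewrite !mxE.
move=> j _; rewrite comp_mpolyZ actX BE scalerDr; congr (_ + _).
by rewrite -mul_mpolyC -mpolyCM [N^T j i]mxE; congr (_%:MP); ring.
Qed.

Lemma msize_dirderiv v p : (msize (dirderiv v p) <= (msize p).-1)%N.
Proof.
have sS := msize_subspace K n (msize p).-1.
by apply: (subspace_sum _ sS) => i _; apply: (subspaceZ _ sS); apply: msize_mderiv.
Qed.

(** As long as some derivative of [g] along the kernel of [N] is nonconstant, it can replace [g],
    with smaller degree. *)
Lemma flow_in_minimal g : W g -> (1 < msize g)%N ->
  exists g', [/\ W g', (1 < msize g')%N
    & forall v, v *m N^T = 0 -> (msize (dirderiv v g') <= 1)%N].
Proof.
have [d] := ubnP (msize g); elim: d g => // d IHd g ltd Wg szg.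
case: (classic (exists v, v *m N^T = 0 /\ (1 < msize (dirderiv v g))%N)).
  move=> [v [vN szv]]; apply: (IHd (dirderiv v g)) => //; last exact: flow_in_dirderiv.
  apply: leq_ltn_trans (msize_dirderiv v g) _.
  by move: szg ltd; case: (msize g).
move=> nex; exists g; split=> // v vN; rewrite leqNgt; apply/negP => szv.
by apply: nex; exists v.
Qed.

Lemma low_rank_direction : (\rank N + 2 <= n)%N -> nonaffine_elem_in K_char0 G.
Proof.
move=> rkN; have [/existsP[j0 szDj]|/existsPn H] := boolP [exists j, 1 < msize (D 'X_j)]%N;
  last first.
  by apply: (constant_direction K_char0 GG Gphi nphi (r := r)) => i; rewrite leqNgt (H i).
have [i /andP[ir _]] := ord_neq2 n_ge3 r r.
have [g [Wg szg gv]] := flow_in_minimal (flow_in_coord K_char0 GG phi ir) (msize_GA_coord phi i).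
(* The gradient of [g] at the origin. Derivatives along the kernel of [N] are constant, hence equal
   to [v *m c]; adding this one condition leaves rank at most [\rank N + 1 < n]. *)
pose c : 'cV[K]_n := \col_i g^`M(i)@_0%MM.
have : kermx (row_mx N^T c) != 0.
  rewrite kermx_eq0 -row_leq_rank -ltnNge -mxrank_tr tr_row_mx trmxK.
  rewrite -addsmxE; apply: leq_trans rkN.
  rewrite addn2 ltnS; apply: (leq_trans (mxrank_adds_leqif N c^T)).
  by rewrite -[leqRHS]addn1 leq_add2l rank_leq_row.
case/rowV0Pn => v /sub_kermxP; rewrite mul_mx_row => E v0.
have [vN vc] : v *m N^T = 0 /\ v *m c = 0 by apply: eq_row_mx; rewrite E row_mx0.
have [k vk] : exists k, v 0 k != 0.
  apply/existsP; apply: contraNT v0; rewrite negb_exists => /forallP H.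
  by apply/eqP/rowP => k; rewrite mxE; apply/eqP; have := H k; rewrite negbK.
apply: (kernel_direction (K_char0 := K_char0) GG Gphi vk _ Wg _ szg _ szDj); last by rewrite msizeX1.
  by move=> q; apply: dirderiv_comm.
rewrite -/(dirderiv v g) (msize1_polyC (gv v vN)) (_ : _@_ _ = 0) ?mpolyC0 //.
rewrite raddf_sum /=; have /matrixP/(_ 0 0) := vc; rewrite !mxE => vc0; rewrite -[RHS]vc0.
by apply: eq_bigr => j _; rewrite mcoeffZ mxE.
Qed.

(** By the Sylvester rank inequality each further factor [N] lowers the rank by at most one. *)
Lemma rank_exp_ge d : (n <= \rank N + 1)%N -> (n <= \rank (N ^+ d) + d)%N.
Proof.
move=> rkN; elim: d => [|d IHd]; first by rewrite expr0 mxrank1 addn0.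
have := mxrank_mul_min (N ^+ d) N; rewrite exprSr.
rewrite leq_subLR => H; rewrite -(leq_add2l n) (leq_trans (leq_add IHd rkN)) //.
rewrite addnACA [(d + 1)%N]addn1 [X in (_ <= X)%N]addnA leq_add2r.
exact: H.
Qed.

(* Multiplying a relation between the rows by N ^+ m, for m the largest index with a
   nonzero coefficient, leaves only the multiple of x *m N ^+ n.-1. *)
Lemma chain_unitmx (x : 'rV[K]_n) :
  x *m N ^+ n.-1 != 0 -> x *m N ^+ n = 0 ->
  \matrix_(j, i) (x *m N ^+ (n.-1 - j)) 0 i \in unitmx.
Proof.
move=> xN1 xN; set A := \matrix_(j, i) _.
have xNge d : (n <= d)%N -> x *m N ^+ d = 0.
  by move=> nd; rewrite -(subnKC nd) exprD mulmxA xN mul0mx.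
rewrite -row_free_unit -kermx_eq0; apply/rowV0P => v /sub_kermxP vA.
apply/eqP; apply: contraNT xN1 => v0.
have [k vk] : exists k, v 0 k != 0.
  apply/existsP; apply: contraNT v0; rewrite negb_exists => /forallP H.
  by apply/eqP/rowP => k; rewrite mxE; apply/eqP; have := H k; rewrite negbK.
case: (arg_maxnP (fun j : 'I_n => j : nat) (P := fun j => v 0 j != 0) vk) => m vm maxm.
have := congr1 (fun y => y *m N ^+ m) vA; rewrite mul0mx.
have -> : v *m A = \sum_j v 0 j *: (x *m N ^+ (n.-1 - j)).
  apply/rowP => i; rewrite mxE summxE; apply: eq_bigr => j _.
  by rewrite [A j i]mxE [RHS]mxE.
rewrite mulmx_suml (bigD1 m) //= big1 => [|j jm].
  rewrite addr0 -scalemxAl mulmx_expD subnK; last first.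
    by rewrite -ltnS prednK // (leq_ltn_trans _ n_ge3).
  by move/eqP; rewrite scaler_eq0 (negPf vm).
have [mj|] := ltnP m j.
  case: (eqVneq (v 0 j) 0) => [->|/maxm]; first by rewrite scale0r mul0mx.
  by rewrite /= leqNgt mj.
rewrite leq_eqVlt val_eqE (negPf jm) /= => ltjm.
rewrite -scalemxAl mulmx_expD xNge ?scaler0 //.
have ltjn : (j <= n.-1)%N by rewrite -ltnS prednK // (leq_ltn_trans _ n_ge3).
apply: (@leq_trans (n.-1 - j + j.+1)); last by rewrite leq_add2l.
by rewrite addnS subnK // prednK // (leq_ltn_trans _ n_ge3).
Qed.

Lemma high_rank_direction : (n <= \rank N + 1)%N -> nonaffine_elem_in K_char0 G.
Proof.
move=> rkN; case: (ex_minnP linear_mx_nilpotent) => M /eqP NM minM.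
have nM : (n <= M)%N by have := rank_exp_ge M rkN; rewrite NM mxrank0.
have n0 : (0 < n)%N by rewrite (leq_ltn_trans _ n_ge3).
have [i Ni] : exists i, row i (N ^+ M.-1) != 0.
  apply/existsP; rewrite -negb_forall; apply/negP => /forallP H.
  have /minM : N ^+ M.-1 == 0.
    by apply/eqP/row_matrixP => i; rewrite row0; apply/eqP.
  by rewrite leqNgt prednK ?leqnn // (leq_trans n0).
(* The shift by [M - n] makes the linear part of [y0] killed by [N ^+ n] but not by [N ^+ n.-1]. *)
pose y0 := iter (M - n) D 'X_i.
have [|y0sz y0lin] := @iter_D_affine (M - n) 'X_i; first by rewrite msizeX1.
rewrite linear_partX -/y0 in y0sz y0lin.
have lin_iter d : linear_part (iter d D y0) = row i (N ^+ (M - n + d)).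
  by rewrite (iter_D_affine d y0sz).2 y0lin mulmx_expD -rowE.
have iter_sz d : (msize (iter d D y0) <= 2)%N by exact: (iter_D_affine d y0sz).1.
(* The indices run backwards so that [D] sends [y j] to its predecessor; these are the new affine
   coordinates. *)
pose y (j : 'I_n) := iter (n.-1 - j) D y0.
have uA : \matrix_(j, k) (linear_part y0 *m N ^+ (n.-1 - j)) 0 k \in unitmx.
  apply: chain_unitmx.
    rewrite y0lin mulmx_expD -rowE -subn1 addnBA // subnK // subn1.
    exact: Ni.
  by rewrite y0lin mulmx_expD -rowE subnK // NM row0.
have [B0 aB0 B0E] := aff_exists (fun j => (y j)@_0%MM) uA.
have {}B0E j : GA_coord B0 j = y j.
  rewrite B0E [RHS](affine_mpolyE (iter_sz _)) addrC; congr (_ + _).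
  apply: eq_bigr => k _; congr (_ *: _).
  by rewrite [LHS]mxE -(iter_D_affine (n.-1 - j) y0sz).2 mxE.
pose B := (B0^-1)%g.
have yB j : y j \oo B = 'X_j by rewrite -B0E -actX actK.
have DB j : pull_deriv (phi * B)%g r 'X_j = D (y j) \oo B.
  by rewrite -yB pull_deriv_mul.
(* [D^n y0] is constant, its linear part being a row of [N ^+ M = 0]. *)
pose a := (iter n D y0)@_0%MM.
have aE : iter n D y0 = a%:MP.
  rewrite (affine_mpolyE (iter_sz n)) big1 ?addr0 // => k _.
  have /rowP/(_ k) := lin_iter n; rewrite subnK // NM row0 !mxE => ->.
  by rewrite scale0r.
pose z : 'I_n := Ordinal n0.
have DBz : pull_deriv (phi * B)%g r 'X_z = a%:MP.
  by rewrite DB /y /= subn0 -iterS prednK // aE comp_mpolyC.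
have DBS (j k : 'I_n) : k = j.+1 :> nat -> pull_deriv (phi * B)%g r 'X_k = 'X_j.
  move=> kj; rewrite DB -[RHS]yB (_ : D (y k) = y j) //.
  have j1 : (0 < n.-1 - j)%N by rewrite subn_gt0 -ltnS prednK // -kj.
  by rewrite /y kj -iterS subnS (prednK j1).
have GB : G (phi * B)%g.
  by case: GG => _ GM GV; apply: GM => //; apply: GV; apply: Gaff.
(* Otherwise D would vanish at a point, contradicting D H_r = 1. *)
have a0 : a != 0.
  apply/negP => /eqP a0.
  have /(congr1 (meval (fun=> 0))) := pull_deriv_coord (phi * B)%g r r.
  rewrite (derivationE _ (derivation_pull _ _)) raddf_sum /= big1.
    by rewrite mevalC eqxx => /eqP; rewrite eq_sym oner_eq0.
  move=> k _; rewrite mevalM; case E: (nat_of_ord k) => [|k'].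
    by rewrite (_ : k = z) ?DBz ?a0 ?mevalC ?mulr0 //; apply: val_inj.
  have lt : (k' < n)%N by rewrite (ltn_trans _ (ltn_ord k)) // E.
  by rewrite (DBS (Ordinal lt) k) // mevalXU mulr0.
have n1 : (n.-1 < n)%N by rewrite prednK.
have n2 : (n.-2 < n)%N by rewrite (leq_ltn_trans (leq_pred _)).
apply: (@chain_direction _ _ K_char0 G GG (phi * B)%g r GB z (Ordinal n2) (Ordinal n1) a) => //=.
  by rewrite !prednK // -subn1 subn_gt0 ltnW.
by rewrite prednK.
Qed.

Lemma nonaffine_elem_exists : nonaffine_elem_in K_char0 G.
Proof.
have [|] := leqP (\rank N + 2) n; first exact: low_rank_direction.
by rewrite addn2 ltnS -addn1 => /high_rank_direction.
Qed.

End LinearPart.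

(** * From conjugates of translations to the theorem *)

(** [D 'X_i] is the first-order term in [c] of the [i]-th coordinate of [phi^-1 * theta r c * phi],
    and polynomials of degree at most one form a subspace. *)
Lemma pull_deriv_affine (K : fieldType) (K_char0 : [pchar K]%R =i pred0) (n : nat)
    (phi : GA K n) (r : 'I_n) :
  (forall c : K, affine (phi^-1 * theta r c * phi)%g) ->
  forall i, (msize (pull_deriv phi r 'X_i) <= 2)%N.
Proof.
move=> aff i; pose F j : {poly {mpoly K[n]}} := (GA_coord phi j)%:P + 'X *+ (j == r).
have := @subspace_first_order _ _ K_char0 _ ('X_i \oo phi^-1%g) F (msize_subspace K n 2).
have -> : nth_fun (fun j => (F j)`_0) = GA_endo phi.
  apply: eq_from_tnth => j; rewrite tnth_mktuple coefD coefC coefMn coefX mul0rn addr0 //.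
rewrite (bigD1 r) //= big1 ?addr0 => [|j jr]; last first.
  by rewrite coefD coefC coefMn coefX (negPf jr) /= mulr0n add0r mulr0.
rewrite coefD coefC coefMn coefX eqxx /= add0r mulr1n mulr1; apply=> a.
have -> : nth_fun (fun j => (F j).[a%:R]) = GA_endo (theta r a%:R * phi)%g.
  apply: eq_from_tnth => j; rewrite -[RHS]/(GA_coord _ j) GA_coordM.
  rewrite tnth_mktuple /F hornerD hornerC hornerMn hornerX /GA_coord tnth_mktuple.
  case: (j == r); rewrite ?comp_mpolyD actX /GA_coord ?comp_mpolyC ?mulr0n ?addr0 //.
  by rewrite mpolyC_nat mulr1n.
rewrite -actM mulgA actX; exact: (affineP _).1.
Qed.

Local Close Scope ring_scope.

Theorem theorem3 (K : fieldType) (K_char0 : [pchar K]%R =i pred0)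
    (n : nat) (n_ge3 : 3 <= n) (phi : GA K n) (r : 'I_n)
    (phi_theta : forall c : K, affine (phi^-1 * theta r c * phi)%g) :
  affine phi \/ cotame phi.
Proof.
case: (classic (affine phi)) => [|nphi]; [by left | right => psi tpsi].
pose G := generated_by (fun rho : GA K n => rho = phi \/ affine rho).
have GG : affine_overgroup G.
  split=> [rho arho|rho rho'|rho]; last exact: generated_by_V.
    by apply: generated_by_in; right.
  exact: generated_by_M.
have Gphi : G phi by apply: generated_by_in; left.
have [k [f [Vf szf]]] := nonaffine_elem_exists K_char0 n_ge3 GG Gphi nphi
  (pull_deriv_affine K_char0 phi_theta).
exact: (tame_sub GG n_ge3 Vf szf tpsi).
Qed.
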